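(* The set $$\{f\in C[0,1]: f \text{ has the Bruckner--Garg property}\}$$ is Haar ambivalent in $C[0,1]$.
   Context: $C[0,1]$ is the Banach space of continuous functions $f\colon[0,1]\to\mathbb{R}$ with the supremum metric, regarded as an abelian Polish group under addition. A set $A\subset C[0,1]$ is shy (or Haar null) if there exist a Borel set $B\subset C[0,1]$ and a Borel probability measure $\mu$ on $C[0,1]$ such that $A\subset B$ and $\mu(B+f)=0$ for all $f\in C[0,1]$. A set is prevalent if its complement is shy. A set is Haar ambivalent if it is neither shy nor prevalent. A Cantor set is a set homeomorphic to the classical middle-third Cantor set. A function $f\in C[0,1]$ has the Bruckner--Garg property if there is a countable dense set $D_f\subset(\min f,\max f)$ such that (1) $f^{-1}(y)$ is a singleton if $y\in\{\min f,\max f\}$; (2) $f^{-1}(y)$ is a Cantor set if $y\in(\min f,\max f)\setminus D_f$; (3) $f^{-1}(y)$ is the union of a Cantor set and an isolated point if $y\in D_f$. *)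

(* Defs.v *)
From HB Require Import structures.
From mathcomp Require Import all_boot all_order all_algebra.
From mathcomp Require Import all_classical all_reals all_analysis.

Set Implicit Arguments.
Unset Strict Implicit.
Unset Printing Implicit Defensive.

Import Order.TTheory GRing.Theory Num.Theory.
Import numFieldNormedType.Exports.

Local Open Scope classical_set_scope.
Local Open Scope ring_scope.

(* [0, 1] with the subspace topology of R. *)
Notation unit_interval R := (set_type (`[0%R : R, 1%R]%classic)).

Lemma unit_interval_nonempty (R : realType) : [set: unit_interval R] !=set0.
Proof.
have h : 0 \in `[0 : R, 1]%classic by rewrite inE /= in_itv /= lexx ler01.
by exists (exist _ 0 h).
Qed.

Lemma unit_interval_compact (R : realType) : compact [set: unit_interval R].
Proof.
move=> F PF _.
have F01 : F (set_val @^-1` `[0, 1]) by apply: filterE => y; exact: set_valP.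
have [x [x01 clx]] := @segment_compact R 0 1 (set_val @ F) _ F01.
exists (exist _ x (mem_set x01)); split=> // A B FA [_ [[W oW <-] Wx WB]].
have [|_ [[y Ay <-] Wy]] := clx ([set set_val z | z in A] : set R) W _ (open_nbhs_nbhs (conj oW Wx)).
  by apply: (@filterS _ F _ A) FA => y Ay; exists y.
by exists y; split=> //; exact: WB.
Qed.

Definition C01 (R : realType) : Type := continuousType (unit_interval R) R.

HB.instance Definition _ (R : realType) := Choice.on (C01 R).

Section C01_lmodule.
Context {R : realType}.
Implicit Types f g h : C01 R.

Lemma C01_eq f g : f =1 g -> f = g.
Proof. by move=> fg; apply/(@continuousEP (unit_interval R) R f g). Qed.

Lemma C01_continuous f : continuous (f : unit_interval R -> R).
Proof. exact: (@cts_fun _ _ f). Qed.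

Local Lemma cts0 : continuous (fun _ : unit_interval R => 0 : R).
Proof. exact: cst_continuous. Qed.

Local Lemma ctsN f : continuous (fun x => - f x).
Proof. by move=> x; apply: (@cvgN R R _ (nbhs x)); exact: (@cts_fun _ _ f). Qed.

Local Lemma ctsD f g : continuous (fun x => f x + g x).
Proof.
move=> x; apply: (@cvgD R R _ (nbhs x)); [exact: (@cts_fun _ _ f)|].
exact: (@cts_fun _ _ g).
Qed.

Local Lemma ctsZ (a : R) f : continuous (fun x => a * f x).
Proof.
move=> x; apply: (@cvgM R _ (nbhs x)); first exact: cvg_cst.
exact: (@cts_fun _ _ f).
Qed.

Definition C01_zero : C01 R := mkcts cts0.
Definition C01_opp f : C01 R := mkcts (@ctsN f).
Definition C01_add f g : C01 R := mkcts (@ctsD f g).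
Definition C01_scale (a : R) f : C01 R := mkcts (@ctsZ a f).

Let addA : associative C01_add.
Proof. by move=> f g h; apply: C01_eq => x; exact: addrA. Qed.
Let addC : commutative C01_add.
Proof. by move=> f g; apply: C01_eq => x; exact: addrC. Qed.
Let add0 : left_id C01_zero C01_add.
Proof. by move=> f; apply: C01_eq => x; exact: add0r. Qed.
Let addN : left_inverse C01_zero C01_opp C01_add.
Proof. by move=> f; apply: C01_eq => x; exact: addNr. Qed.

HB.instance Definition _ := GRing.isZmodule.Build (C01 R) addA addC add0 addN.

Let scaleA a b f : C01_scale a (C01_scale b f) = C01_scale (a * b) f.
Proof. by apply: C01_eq => x; exact: mulrA. Qed.
Let scale1 : left_id 1 C01_scale.
Proof. by move=> f; apply: C01_eq => x; exact: mul1r. Qed.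
Let scaleDr : right_distributive C01_scale +%R.
Proof. by move=> a f g; apply: C01_eq => x; exact: mulrDr. Qed.
Let scaleDl f : {morph C01_scale^~ f : a b / a + b}.
Proof. by move=> a b; apply: C01_eq => x; exact: mulrDl. Qed.

HB.instance Definition _ := GRing.Zmodule_isLmodule.Build R (C01 R)
  scaleA scale1 scaleDr scaleDl.

Lemma C01_addE f g x : (f + g) x = f x + g x. Proof. by []. Qed.
Lemma C01_oppE f x : (- f) x = - f x. Proof. by []. Qed.
Lemma C01_zeroE x : (0 : C01 R) x = 0. Proof. by []. Qed.
Lemma C01_scaleE (a : R) f x : (a *: f) x = a * f x. Proof. by []. Qed.

End C01_lmodule.

Section C01_normed.
Context {R : realType}.
Implicit Types f g : C01 R.

Definition sup_norm f : R := sup (range (fun x => `|f x|)).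

Lemma has_sup_norm f : has_sup (range (fun x => `|f x|)).
Proof.
split.
  by have [x _] := unit_interval_nonempty R; exists `|f x|, x.
have cf : {within [set: unit_interval R], continuous (fun x => `|f x|)}.
  apply: continuous_subspaceT => x; apply: (@cvg_norm R R _ (nbhs x)).
  exact: C01_continuous.
have [c _ cmax] := compact_EVT_max (unit_interval_nonempty R)
  (@unit_interval_compact R) cf.
by exists `|f c| => _ [x _ <-]; exact/cmax/mem_set.
Qed.

Lemma sup_norm_ge f x : `|f x| <= sup_norm f.
Proof.
by apply: sup_upper_bound; [exact: has_sup_norm|exists x].
Qed.

Lemma sup_norm_le f (M : R) : (forall x, `|f x| <= M) -> sup_norm f <= M.
Proof.
move=> fM; apply: ge_sup; first exact: (has_sup_norm f).1.
by move=> _ [x _ <-].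
Qed.

Let sup_normD f g : sup_norm (f + g) <= sup_norm f + sup_norm g.
Proof.
apply: sup_norm_le => x; apply: le_trans (ler_normD _ _) _.
by apply: lerD; exact: sup_norm_ge.
Qed.

Let sup_normZ_le (a : R) f : sup_norm (a *: f) <= `|a| * sup_norm f.
Proof.
apply: sup_norm_le => x.
by rewrite [X in `|X|](_ : _ = a * f x)// normrM ler_wpM2l// sup_norm_ge.
Qed.

Let sup_normZ (a : R) f : sup_norm (a *: f) = `|a| * sup_norm f.
Proof.
apply/eqP; rewrite eq_le sup_normZ_le/=.
have [->|a0] := eqVneq a 0.
  rewrite normr0 mul0r; have [x _] := unit_interval_nonempty R.
  exact: le_trans (sup_norm_ge _ x).
rewrite -ler_pdivlMl ?normr_gt0// -normfV.
by rewrite -{1}(scale1r f) -(mulVf a0) -scalerA sup_normZ_le.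
Qed.

Let sup_norm_eq0 f : sup_norm f = 0 -> f = 0.
Proof.
move=> f0; apply: C01_eq => x; apply/eqP.
by rewrite -normr_le0; apply: le_trans (sup_norm_ge f x) _; rewrite f0.
Qed.

HB.instance Definition _ := Lmodule_isNormed.Build R (C01 R)
  sup_normD sup_normZ sup_norm_eq0.

Lemma C01_normE f : `|f| = sup (range (fun x => `|f x|)).
Proof. by []. Qed.

Lemma C01_ballE f (e : R) : ball f e = [set g | sup_norm (f - g) < e].
Proof. by []. Qed.

End C01_normed.

(* V with its Borel sigma-algebra. *)
Notation borel_type V := (g_sigma_algebraType (@open V)).

Section haar_null.
Context {R : realType} {V : normedModType R}.
Implicit Types A B : set V.

Definition shy A : Prop :=
  exists (B : set V) (mu : probability (borel_type V) R),
    [/\ measurable (B : set (borel_type V)), A `<=` B &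
        forall f : V, mu [set g + f | g in B] = 0%E].

Definition prevalent A : Prop := shy (~` A).

Definition haar_ambivalent A : Prop := ~ shy A /\ ~ prevalent A.

End haar_null.

Definition homeomorphic (T U : topologicalType) : Prop :=
  exists (f : T -> U) (g : U -> T),
    [/\ continuous f, continuous g, cancel f g & cancel g f].

Section cantor.
Context {R : realType}.

Fixpoint cantor_stage (n : nat) : set R :=
  if n is m.+1 then
    [set x / 3 | x in cantor_stage m] `|` [set (x + 2) / 3 | x in cantor_stage m]
  else `[0, 1]%classic.

Definition middle_third_cantor : set R := \bigcap_n cantor_stage n.

Definition is_cantor_set (A : set (unit_interval R)) : Prop :=
  homeomorphic A middle_third_cantor.

End cantor.

Section bruckner_garg.
Context {R : realType}.
Implicit Type f : C01 R.

Definition min_value f : R := inf (range f).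
Definition max_value f : R := sup (range f).

Lemma min_valueP f : exists2 c, f c = min_value f & forall x, min_value f <= f x.
Proof.
have cf : {within [set: unit_interval R], continuous f}.
  by apply: continuous_subspaceT; exact: C01_continuous.
have [c _ cmin] := compact_EVT_min (unit_interval_nonempty R)
  (@unit_interval_compact R) cf.
have fc : f c = min_value f.
  apply/eqP; rewrite eq_le; apply/andP; split.
    apply: lb_le_inf; first by exists (f c), c.
    by move=> _ [x _ <-]; exact/cmin/mem_set.
  apply: ge_inf; last by exists c.
  by exists (f c) => _ [x _ <-]; exact/cmin/mem_set.
by exists c => // x; rewrite -fc; exact/cmin/mem_set.
Qed.

Lemma max_valueP f : exists2 c, f c = max_value f & forall x, f x <= max_value f.
Proof.
have cf : {within [set: unit_interval R], continuous f}.
  by apply: continuous_subspaceT; exact: C01_continuous.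
have [c _ cmax] := compact_EVT_max (unit_interval_nonempty R)
  (@unit_interval_compact R) cf.
have fc : f c = max_value f.
  apply/eqP; rewrite eq_le; apply/andP; split.
    apply: ub_le_sup; last by exists c.
    by exists (f c) => _ [x _ <-]; exact/cmax/mem_set.
  apply: ge_sup; first by exists (f c), c.
  by move=> _ [x _ <-]; exact/cmax/mem_set.
by exists c => // x; rewrite -fc; exact/cmax/mem_set.
Qed.

Definition bruckner_garg f : Prop :=
  exists D : set R,
    [/\ countable D, D `<=` `]min_value f, max_value f[,
        `]min_value f, max_value f[ `<=` closure D &
    [/\ forall y, [set min_value f; max_value f] y ->
          exists x, f @^-1` [set y] = [set x],
        forall y, (`]min_value f, max_value f[ `\` D) y ->
          is_cantor_set (f @^-1` [set y]) &
        forall y, D y ->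
          exists (C : set (unit_interval R)) (x : unit_interval R),
            [/\ is_cantor_set C, isolated (f @^-1` [set y]) x &
                f @^-1` [set y] = C `|` [set x]]]].

End bruckner_garg.

(* Main.v *)
Require Import Defs.
From HB Require Import structures.
From mathcomp Require Import all_boot all_order all_algebra.
From mathcomp Require Import all_classical all_reals all_analysis measurable_realfun.
From mathcomp Require Import zify ring lra.

Set Implicit Arguments.
Unset Strict Implicit.
Unset Printing Implicit Defensive.

Import Order.TTheory GRing.Theory Num.Theory.
Import numFieldNormedType.Exports.

Local Open Scope classical_set_scope.
Local Open Scope ring_scope.

(** A set is not shy as soon as, for every Borel probability measure mu, some
    translate of it contains a set of positive mu-measure ([not_shy]).  Given
    mu, the continuous functions are exhausted, for each scale, by the sets of
    functions with prescribed oscillation at that scale; hence a class of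
    uniformly bounded, uniformly equicontinuous functions has positive measure
    ([equicontinuous_class_positive]).  In both halves it is thus enough to
    exhibit one continuous f such that f + g behaves as wanted for almost all g
    obeying a prescribed modulus of continuity.

    Such an f is a zigzag function.  The interval is cut into meshes, each
    segment of a mesh being cut into an odd number of equal segments of the
    next one.  Where f goes from u to v over a segment, in the next mesh it goes
    from u to the relative height 3/4, then oscillates between 3/4 and 1/4, and
    ends at v.  Over a segment of mesh n the function f moves by at least
    A / 2^n, whereas the segment can be made as short as the modulus requires,
    so that adding g does not alter the shape of f.  Let h = f + g.  On every
    segment, h stays strictly between its two end values ([perturbed_gt_left],
    [perturbed_lt_right]); so h has its only minimum at 0 and its only maximum
    at 1, and all other nodes are strict local extrema, dense and isolated in
    their level sets.  No other point is isolated in its level set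
    ([perturbed_not_isolated]).  A nonempty compact subset of the line that has no
    isolated point and misses a dense set is a Cantor set ([is_cantor_setP]), so
    each intermediate level set of h is a Cantor set together with the nodes it
    contains.

    The Bruckner-Garg property also demands that distinct nodes have distinct
    values.  That holds for almost every g once f is replaced by f + c id for a
    suitable c in [0, 1].  Indeed two given nodes d and d' have the same value
    only if g d - g d' takes a certain value depending injectively on c; this
    value is an atom of the distribution of g d - g d' for countably many c, and
    there are countably many pairs of nodes.

    For the complement, two copies of the zigzag function are glued in a
    point-symmetric way around 1/2.  As each copy keeps its strict minimum at
    the gluing point, f + g lies below its value at 1/2 on the left and above it
    on the right.  The level set through 1/2 is a single point, which is neither
    a Cantor set nor a Cantor set with one point added. *)

(** * Recognizing Cantor sets *)

Section cantor_like.
Context {R : realType}.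

Lemma geometric_small (q e : R) : 0 <= q < 1 -> 0 < e -> exists n, q ^+ n < e.
Proof.
move=> q01 e0; have /cvgrPdist_lt /(_ e e0) : q ^+ n @[n --> \oo] --> 0.
  by apply: cvg_expr; rewrite ger0_norm; lra.
move=> [n _ /(_ n (leqnn n))] /=; rewrite sub0r normrN ger0_norm; last first.
  by apply: exprn_ge0; lra.
by exists n.
Qed.

Lemma unit_bounds (u : unit_interval R) : 0 <= set_val u <= 1.
Proof. by have := set_valP u; rewrite /= in_itv. Qed.

(** Both spaces are homeomorphic to the product of countably many two-point
    spaces; the points p and q witness that the spaces are inhabited. *)
Lemma cantor_like_homeomorphic (T U : pseudoMetricType R) (p : T) (q : U) :
  cantor_like T -> cantor_like U -> homeomorphic T U.
Proof.
move=> cT cU.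
have from_cantor (V : pseudoMetricType R) (v : V) : cantor_like V ->
    exists (f : cantor_space -> V) (g : V -> cantor_space),
      [/\ continuous f, continuous g, cancel f g & cancel g f].
  move=> cV; pose V' : pseudoPMetricType R := HB.pack V (isPointed.Build V v).
  have [f [cf clf]] := @homeomorphism_cantor_like R V' cV.
  exists f, (f^-1)%FUN; split => //.
  - apply/continuousP => A oA.
    (* f is closed, so its inverse is continuous. *)
    have -> : (f^-1)%FUN @^-1` A = ~` (f @` (~` A)).
      apply/seteqP; split => [x /= Ax [y nAy fyx]|x /= nx].
        by move: Ax; rewrite -fyx funK ?inE// => /nAy.
      by apply: contrapT => nA; apply: nx; exists ((f^-1)%FUN x) => //; rewrite invK ?inE.
    by rewrite openC; apply: clf; rewrite closedC.
  - by move=> x; rewrite funK ?inE.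
  - by move=> x; rewrite invK ?inE.
have [f [g [cf cg fK gK]]] := from_cantor _ p cT.
have [h [k [ch ck hK kK]]] := from_cantor _ q cU.
exists (h \o g), (f \o k); split.
- by move=> x; apply: continuous_comp; [exact: cg|exact: ch].
- by move=> x; apply: continuous_comp; [exact: ck|exact: cf].
- by move=> x /=; rewrite hK gK.
- by move=> x /=; rewrite fK kK.
Qed.

(** The values of i omit a value between any two of them, and cutting at an
    omitted value gives a clopen set.  The third hypothesis makes i a
    homeomorphism onto its image, so that open sets can be tested with
    distances in R. *)
Lemma cantor_like_of_embedding (T : topologicalType) (i : T -> R) :
  continuous i -> injective i ->
  (forall x U, nbhs x U ->
     exists2 e, 0 < e & forall y, `|i x - i y| < e -> U y) ->
  compact [set: T] ->
  (forall x e, 0 < e -> exists2 y, y != x & `|i x - i y| < e) ->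
  (forall x y, i x < i y ->
     exists2 c, i x < c < i y & forall z, i z != c) ->
  cantor_like T.
Proof.
move=> ci ii emb cT acc gap.
have zd : zero_dimensional T.
  have clopen_lt c : (forall z, i z != c) -> clopen [set z | i z < c].
    move=> nc; split; first by apply: (open_comp _ (@open_lt R c)) => z _; exact: ci.
    rewrite -openC.
    suff -> : ~` [set z | i z < c] = [set z | c < i z].
      by apply: (open_comp _ (@open_gt R c)) => z _; exact: ci.
    apply/seteqP; split => z /=; first by move=> /negP; rewrite -leNgt lt_neqAle eq_sym nc.
    by move=> cz; apply/negP; rewrite -leNgt ltW.
  move=> x y xy.
  have : i x != i y by apply: contra_neq xy => /ii.
  rewrite neq_lt => /orP[/gap|/gap] [c /andP[c1 c2] nc].
    exists [set z | i z < c]; split => //=; first exact: clopen_lt.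
    by apply/negP; rewrite -leNgt ltW.
  exists (~` [set z | i z < c]); split.
  - by apply: (clopenC set0); exact: clopen_lt.
  - by apply/negP; rewrite -leNgt ltW.
  - by move=> /(_ c1).
split => //.
- apply/perfectTP => x ox.
  have /emb[e e0 He] : nbhs x [set x] by exact: open_nbhs_nbhs.
  by have [y /eqP yx /He] := acc x e e0.
- move=> x y; apply: contraPP => /eqP /zd[U [[oU cU] Ux nUy]] /(_ U (~` U)).
  case.
  + exact: open_nbhs_nbhs.
  + by apply: open_nbhs_nbhs; split; [exact: closed_openC|].
  + by move=> z [].
Qed.

Lemma compact_set_type (X : topologicalType) (A : set X) :
  compact A -> compact [set: A].
Proof.
move=> cA F PF _.
have FA : F (set_val @^-1` A) by apply: filterE => y; exact: set_valP.
have [x [Ax clx]] := cA (set_val @ F) _ FA.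
exists (SigSub (mem_set Ax)); split=> // B C FB [_ [[W oW <-] Wx WC]].
have [|_ [[y By <-] Wy]] := clx [set set_val z | z in B] W _ (open_nbhs_nbhs (conj oW Wx)).
  by apply: (@filterS _ F _ B) FB => y By; exists y.
by exists y; split=> //; exact: WC.
Qed.

End cantor_like.

Section middle_third.
Context {R : realType}.
Local Notation stage := (@cantor_stage R).
Local Notation mt := (@middle_third_cantor R).

Lemma cantor_stage01 n x : stage n x -> 0 <= x <= 1.
Proof.
elim: n x => [x|n IH x] /=; first by rewrite in_itv.
by case=> -[y /IH/andP[y0 y1] <-]; lra.
Qed.

Lemma closed_cantor_stage n : closed (stage n).
Proof.
have affine_cts (u v : R) : continuous (fun x => u * x + v).
  by move=> x; apply: cvgD; [apply: cvgM; [exact: cvg_cst|exact: cvg_id]|exact: cvg_cst].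
elim: n => [|n IH] /=; first exact: interval_closed.
apply: closedU.
- rewrite (_ : [set _ | _ in _] = (fun x => 3 * x + 0) @^-1` stage n).
    by apply: closed_comp => // x _; exact: affine_cts.
  apply/seteqP; split => [_ [x sx <-] /=|x /= sx].
    by rewrite (_ : 3 * _ + 0 = x)//; field.
  by exists (3 * x + 0) => //; field.
- rewrite (_ : [set _ | _ in _] = (fun x => 3 * x + (- 2)) @^-1` stage n).
    by apply: closed_comp => // x _; exact: affine_cts.
  apply/seteqP; split => [_ [x sx <-] /=|x /= sx].
    by rewrite (_ : 3 * _ + _ = x)//; field.
  by exists (3 * x + (- 2)) => //; field.
Qed.

Lemma middle_third01 x : mt x -> 0 <= x <= 1.
Proof. by move=> /(_ 0%N I)/cantor_stage01. Qed.

(** The two thirds of the Cantor set cannot interfere, since every stage lies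
    in the unit interval; this is its self-similarity, on the left third. *)
Lemma middle_third_left y : 0 <= y <= 1 -> mt (y / 3) <-> mt y.
Proof.
move=> /andP[y0 y1]; split => my n _.
  have [[x sx xy]|[x /cantor_stage01 sx xy]] := my n.+1 I; last lra.
  by rewrite (_ : y = x)//; lra.
case: n => [|n] /=; first by rewrite in_itv /=; lra.
by left; exists y => //; exact: my.
Qed.

Lemma middle_third_right y : 0 <= y <= 1 -> mt ((y + 2) / 3) <-> mt y.
Proof.
move=> /andP[y0 y1]; split => my n _.
  have [[x /cantor_stage01 sx xy]|[x sx xy]] := my n.+1 I; first lra.
  by rewrite (_ : y = x)//; lra.
case: n => [|n] /=; first by rewrite in_itv /=; lra.
by right; exists y => //; exact: my.
Qed.

Lemma middle_third_split x : mt x ->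
  exists2 y, mt y & x = y / 3 \/ x = (y + 2) / 3.
Proof.
move=> mx; have [[y sy yx]|[y sy yx]] := mx 1%N I; exists y; rewrite -?yx.
- by apply/middle_third_left; [exact: (@cantor_stage01 0)|rewrite yx].
- by left.
- by apply/middle_third_right; [exact: (@cantor_stage01 0)|rewrite yx].
- by right.
Qed.

Lemma middle_third_0 : mt 0.
Proof.
move=> n _; elim: n => [|n IH] /=; first by rewrite in_itv /=; lra.
by left; exists 0 => //; rewrite mul0r.
Qed.

Lemma middle_third_1 : mt 1.
Proof.
move=> n _; elim: n => [|n IH] /=; first by rewrite in_itv /=; lra.
by right; exists 1 => //; field.
Qed.

(** The accumulation is proved with a rate, so that self-similarity turns the
    induction step into a rescaling by 1/3; at rank 0 an endpoint of the unit
    interval does. *)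
Lemma middle_third_perfect n x : mt x ->
  exists y, [/\ mt y, y != x & `|x - y| <= 3^-1 ^+ n].
Proof.
elim: n x => [|n IH] x mx.
  have /andP[x0 x1] := middle_third01 mx.
  have [->|xn0] := eqVneq x 0.
    by exists 1; split; [exact: middle_third_1|exact: oner_neq0|rewrite sub0r normrN1].
  exists 0; split; [exact: middle_third_0|by rewrite eq_sym|].
  by rewrite subr0 ger0_norm.
have [y my xy] := middle_third_split mx.
have [z [mz zy yz]] := IH y my.
have scale : `|(y - z) / 3| <= 3^-1 ^+ n.+1.
  by rewrite normrM (ger0_norm (_ : 0 <= 3^-1))// exprSr ler_wpM2r.
have z01 := middle_third01 mz.
case: xy => ->.
  exists (z / 3); split; first exact/middle_third_left.
    by apply: contra_neq zy => zy; lra.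
  by rewrite -mulrBl.
exists ((z + 2) / 3); split; first exact/middle_third_right.
  by apply: contra_neq zy => zy; lra.
by rewrite -mulrBl (_ : _ - _ = y - z)//; ring.
Qed.

(** Two points in different thirds are separated by 1/2, and two points in the
    same third become three times as distant after rescaling. *)
Lemma middle_third_gap n x y : mt x -> mt y -> 3^-1 ^+ n < y - x ->
  exists2 c, x < c < y & ~ mt c.
Proof.
elim: n x y => [|n IH] x y mx my.
  by have := middle_third01 mx; have := middle_third01 my; rewrite expr0; lra.
rewrite exprSr.
have [a ma xa] := middle_third_split mx; have [b mb yb] := middle_third_split my.
have := middle_third01 ma; have := middle_third01 mb => b01 a01 xy.
have p0 : 0 < (3^-1 : R) ^+ n by apply: exprn_gt0; lra.
have sub : 3^-1 ^+ n < b - a -> exists2 c, a < c < b & ~ mt c by exact: IH.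
case: xa xy => -> ; case: yb => -> xy.
- have [|c cab nc] := sub; first lra.
  exists (c / 3); first lra.
  by move/middle_third_left => /(_ _)/nc; apply; lra.
- exists (2^-1); first lra.
  by move=> m; have [d /middle_third01 d01 [|]] := middle_third_split m; lra.
- lra.
- have [|c cab nc] := sub; first lra.
  exists ((c + 2) / 3); first lra.
  by move/middle_third_right => /(_ _)/nc; apply; lra.
Qed.

Lemma cantor_like_middle_third : cantor_like mt.
Proof.
apply: (@cantor_like_of_embedding R _ (@set_val R mt)).
- exact: initial_continuous.
- exact: val_inj.
- move=> x U [_ [[W oW <-] Wx WU]].
  have /nbhs_ballP[e e0 eW] : nbhs (set_val x) W by exact: open_nbhs_nbhs.
  by exists e => // y xy; apply: WU; exact: eW.
- apply: compact_set_type; apply: (subclosed_compact _ (@segment_compact R 0 1)).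
    by apply: closed_bigI => n _; exact: closed_cantor_stage.
  by move=> x /middle_third01; rewrite /= in_itv.
- have third01 : 0 <= (3^-1 : R) < 1 by lra.
  move=> x e e0; have [n ne] := geometric_small third01 e0.
  have [y [my yx xy]] := middle_third_perfect n (set_valP x).
  exists (SigSub (mem_set my)); first by apply: contra_neq yx => <-.
  exact: le_lt_trans xy ne.
- have third01 : 0 <= (3^-1 : R) < 1 by lra.
  move=> x y; rewrite -subr_gt0 => xy; have [n ne] := geometric_small third01 xy.
  have [c cxy nc] := middle_third_gap (set_valP x) (set_valP y) ne.
  exists c => // z; apply/eqP => zc; apply: nc; rewrite -zc; exact: set_valP.
Qed.

End middle_third.

Section is_cantor.
Context {R : realType}.
Implicit Types (A : set (unit_interval R)).

Lemma closed_compact_unit_interval A : closed A -> compact A.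
Proof.
move=> cA; apply: (subclosed_compact cA (@unit_interval_compact R)).
exact: subsetT.
Qed.

(** A recognition criterion in metric terms only: the middle-third Cantor set
    and A are both compact, without isolated points and nowhere dense in the
    line. *)
Lemma is_cantor_setP A : A !=set0 -> closed A ->
  (forall x e, A x -> 0 < e ->
     exists y, [/\ A y, y != x & `|set_val x - set_val y| < e]) ->
  (forall x y : unit_interval R, set_val x < set_val y ->
     exists2 c, set_val x < set_val c < set_val y & ~ A c) ->
  is_cantor_set A.
Proof.
move=> [a Aa] cA acc gap.
apply: (@cantor_like_homeomorphic R A (@middle_third_cantor R)
  (SigSub (mem_set Aa)) (SigSub (mem_set middle_third_0)) _ cantor_like_middle_third).
apply: (@cantor_like_of_embedding R _ (fun x : A => set_val (set_val x))).
- move=> x; apply: (@continuous_comp _ _ _ set_val set_val); exact: initial_continuous.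
- by move=> x y /val_inj/val_inj.
- move=> x U [_ [[_ [W oW <-] <-] Wx WU]].
  have /nbhs_ballP[e e0 eW] : nbhs (set_val (set_val x)) W by exact: open_nbhs_nbhs.
  by exists e => // y xy; apply: WU; exact: eW.
- exact/compact_set_type/closed_compact_unit_interval.
- move=> x e e0; have [y [Ay yx xy]] := acc (set_val x) e (set_valP x) e0.
  exists (SigSub (mem_set Ay)); last exact: xy.
  by apply: contra_neq yx => <-.
- move=> x y xy; have [c cxy nAc] := gap _ _ xy; exists (set_val c) => // z.
  by apply/eqP => /val_inj zc; apply: nAc; rewrite -zc; exact: set_valP.
Qed.

End is_cantor.

(** * The zigzag function *)

Section zigzag.
Context {R : realType}.
Variables (A : R) (k : nat -> nat).

(** Odd, so that a subdivided segment ends at the value where its parent ends,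
    and at least 3, so that there is room for one oscillation.  Large values of k
    make the next mesh as fine as desired. *)
Definition branching (n : nat) : nat := (k n).*2.+3.

Fixpoint mesh (n : nat) : nat := if n is m.+1 then (mesh m * branching m)%N else 1%N.

Definition node (n j : nat) : R := j%:R / (mesh n)%:R.

(** Relative heights of the N + 1 nodes that subdivide a segment: up to 3/4,
    down to 1/4, and so on, and finally up to 1. *)
Definition profile (N r : nat) : R :=
  if r == 0%N then 0 else if r == N then 1 else if odd r then 3 / 4 else 1 / 4.

(** At mesh 0 the nodes alternate between the values 0 and A on the whole
    half-line, so that consecutive segments always have opposite directions,
    also across an integer. *)
Fixpoint node_val (n j : nat) : R :=
  if n is m.+1 then
    let p := (j %/ branching m)%N in
    node_val m p
      + (node_val m p.+1 - node_val m p) * profile (branching m) (j %% branching m)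
  else A * (odd j)%:R.

Lemma branching_gt2 n : (2 < branching n)%N. Proof. by []. Qed.
Lemma branching_gt0 n : (0 < branching n)%N. Proof. by []. Qed.
Lemma branching_odd n : odd (branching n). Proof. by rewrite /= odd_double. Qed.

Lemma mesh_gt0 n : (0 < mesh n)%N.
Proof. by elim: n => //= n IH; rewrite muln_gt0 IH. Qed.

Lemma meshR_gt0 n : 0 < (mesh n)%:R :> R.
Proof. by rewrite ltr0n mesh_gt0. Qed.

Lemma mesh_ge n : (3 ^ n <= mesh n)%N.
Proof. by elim: n => //= n IH; rewrite expnSr leq_mul. Qed.

Lemma inv_mesh_small (e : R) : 0 < e -> exists n, 3 / (mesh n)%:R < e.
Proof.
move=> e0; exists (Num.truncn (3 / e)).
set n := Num.truncn _; rewrite ltr_pdivrMr ?meshR_gt0// -ltr_pdivrMl// mulrC.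
have : 3 / e < n.+1%:R by apply: real_truncnS_gt; rewrite num_real.
move=> /lt_le_trans; apply; rewrite ler_nat (leq_trans _ (mesh_ge n))//.
exact: ltn_expl.
Qed.

Lemma nodeE n j : node n j = j%:R / (mesh n)%:R.
Proof. by []. Qed.

Lemma node_le n i j : (node n i <= node n j) = (i <= j)%N.
Proof. by rewrite ler_pM2r ?invr_gt0 ?meshR_gt0// ler_nat. Qed.

Lemma node_lt n i j : (node n i < node n j) = (i < j)%N.
Proof. by rewrite ltr_pM2r ?invr_gt0 ?meshR_gt0// ltr_nat. Qed.

Lemma node_ge0 n j : 0 <= node n j.
Proof. by rewrite divr_ge0. Qed.

Lemma nodeS n j : node n.+1 (j * branching n) = node n j.
Proof.
rewrite /node /= !natrM invfM mulrACA divff ?mulr1//.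
by rewrite pnatr_eq0 -lt0n branching_gt0.
Qed.

Lemma nodeD n i j : node n (i + j) = node n i + j%:R / (mesh n)%:R.
Proof. by rewrite /node natrD mulrDl. Qed.

Lemma node_succ n j : node n j.+1 = node n j + (mesh n)%:R^-1.
Proof. by rewrite -addn1 nodeD mul1r. Qed.

Lemma profile0 N : profile N 0 = 0. Proof. by []. Qed.

Lemma profileN N : (0 < N)%N -> profile N N = 1.
Proof. by rewrite /profile eqxx; case: N. Qed.

Lemma profile_in N r : (0 < r < N)%N -> profile N r = if odd r then 3 / 4 else 1 / 4.
Proof. by rewrite /profile => /andP[r0 rN]; rewrite gtn_eqF// ltn_eqF. Qed.

Lemma profile_step N r : odd N -> (2 < N)%N -> (r < N)%N ->
  2^-1 <= (-1) ^+ r * (profile N r.+1 - profile N r) <= 3 / 4.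
Proof.
move=> oN N2; rewrite -signr_odd; case: r => [|r] rN.
  by rewrite profile0 profile_in/=; [lra|lia].
rewrite (@profile_in N r.+1)//.
have [rE|rE] := eqVneq r.+2 N.
  have er : odd r = true by move: oN; rewrite -rE /= negbK.
  by rewrite rE profileN; [rewrite /= er /=; lra|lia].
rewrite profile_in; last by rewrite /= ltn_neqAle rE.
by case: (boolP (odd r)) => /= -> /=; lra.
Qed.

(** An inner step goes from 1/4 to 3/4 or back, and both steps next to it undo
    it at least.  So, in the direction of the step, the node before it lies
    beyond the node after it. *)
Lemma profile_swing N r : odd N -> (0 < r)%N -> (r.+2 <= N)%N ->
  2^-1 <= (-1) ^+ r * (profile N r.-1 - profile N r.+2).
Proof.
move=> oN r0 rN; rewrite -signr_odd; case: r r0 rN => // r _ rN /=.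
have -> : profile N r = if odd r then 3 / 4 else if r == 0%N then 0 else 1 / 4.
  by case: r rN => [|r] rN; [rewrite profile0|rewrite profile_in//; lia].
have -> : profile N r.+3 = if odd r then 1 / 4 else if r.+3 == N then 1 else 3 / 4.
  have [rE|rE] := eqVneq r.+3 N.
    have -> : odd r = false by move: oN; rewrite -rE /= negbK => /negbTE.
    by rewrite -rE profileN.
  by rewrite profile_in/= ?negbK; [case: odd|lia].
by case: odd => /=; [|do 2?case: eqP => _]; lra.
Qed.

Lemma profile_ge N r : (0 < r <= N)%N -> 4^-1 <= profile N r.
Proof.
move=> ?; rewrite /profile; case: eqP => [|_]; first lia.
by case: eqP => _; [|case: odd]; lra.
Qed.

Lemma profile_le N r : (r < N)%N -> profile N r <= 3 / 4.
Proof.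
move=> ?; rewrite /profile; case: eqP => [_|_]; first lra.
by case: eqP => [|_]; [lia|case: odd; lra].
Qed.

Lemma profile01 N r : (r <= N)%N -> 0 <= profile N r <= 1.
Proof.
by move=> ?; rewrite /profile; case: eqP => _; [|case: eqP => _; [|case: odd]]; lra.
Qed.

Lemma node_val_refine n j r : (r <= branching n)%N ->
  node_val n.+1 (j * branching n + r) =
  node_val n j + (node_val n j.+1 - node_val n j) * profile (branching n) r.
Proof.
rewrite leq_eqVlt => /orP[/eqP ->|rN] /=.
  rewrite -mulSnr mulnK ?modnMl ?profile0 ?mulr0 ?addr0 ?profileN ?mulr1 ?branching_gt0//.
  by rewrite addrC subrK.
by rewrite divnMDl ?branching_gt0// divn_small// addn0 modnMDl modn_small.
Qed.

Lemma node_valS n j : node_val n.+1 (j * branching n) = node_val n j.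
Proof. by rewrite -[X in node_val _ X]addn0 node_val_refine// profile0 mulr0 addr0. Qed.

(** The sign (-1)^j is the direction of the segment j of a mesh; as the
    branching is odd, the direction of a subsegment is the product of that of
    its parent and of the direction inside the profile. *)
Lemma sign_refine n j r : (-1) ^+ (j * branching n + r) = (-1) ^+ j * (-1) ^+ r :> R.
Proof.
by rewrite exprD; congr (_ * _); rewrite -signr_odd oddM branching_odd andbT signr_odd.
Qed.

Lemma split_index n i :
  exists j r, [/\ (r < branching n)%N, i = (j * branching n + r)%N & j = (i %/ branching n)%N].
Proof.
exists (i %/ branching n)%N, (i %% branching n)%N; split => //; first exact: ltn_pmod.
exact: divn_eq.
Qed.

Hypothesis A_gt0 : 0 < A.

(** The height of a segment is multiplied by a factor between 1/2 and 3/4 when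
    passing to a subsegment: the lower bound keeps the zigzag larger than its
    perturbation and the upper one makes it continuous. *)
Lemma node_val_step n j :
  A * 2^-1 ^+ n <= (-1) ^+ j * (node_val n j.+1 - node_val n j) <= A * (3 / 4) ^+ n.
Proof.
elim: n j => [|n IH] i.
  rewrite !expr0 !mulr1 /= -signr_odd.
  by case: (odd i) => /=; rewrite ?expr0 ?expr1 ?mulr0 ?mulr1; lra.
have [j [r [rN -> _]]] := split_index n i.
rewrite -addnS !node_val_refine//; last exact: ltnW.
rewrite sign_refine.
set N := branching n; set d := node_val n j.+1 - _.
have := IH j; rewrite -/d => /andP[d1 d2].
have /andP[p1 p2] := profile_step (branching_odd n) (branching_gt2 n) rN.
have -> : node_val n j + d * profile N r.+1 - (node_val n j + d * profile N r)
  = d * (profile N r.+1 - profile N r) by ring.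
rewrite mulrACA !exprSr ![A * (_ * _)]mulrA.
have a0 : 0 <= A * 2^-1 ^+ n by rewrite mulr_ge0 ?exprn_ge0 ?ltW.
by apply/andP; split; apply: ler_pM => //; lra.
Qed.

Definition seg_low n (x : R) := let j := Num.truncn (x * (mesh n)%:R) in
  Num.min (node_val n j) (node_val n j.+1).
Definition seg_high n (x : R) := let j := Num.truncn (x * (mesh n)%:R) in
  Num.max (node_val n j) (node_val n j.+1).

(** The ranges of node values on the nested segments around x shrink to one
    point, which is the value at x.  At x < 0 the truncation is 0, which gives
    the value at the node 0. *)
Definition zigzag (x : R) : R := sup (range (seg_low^~ x)).

Lemma truncn_refine n (x : R) :
  (Num.truncn (x * (mesh n.+1)%:R) %/ branching n)%N = Num.truncn (x * (mesh n)%:R).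
Proof.
have [x0|x0] := leP 0 x; last first.
  have neg m : Num.truncn (x * (mesh m)%:R) = 0%N.
    apply/truncn0Pn; rewrite -ltNge (lt_trans _ ltr01)//.
    by rewrite pmulr_llt0 ?meshR_gt0.
  by rewrite !neg div0n.
apply/esym/truncn_def.
have := @truncn_itv R (x * (mesh n.+1)%:R); rewrite mulr_ge0// => /(_ isT).
set i := Num.truncn _; rewrite /= natrM mulrA => /andP[i1 i2].
have N0 : 0 < (branching n)%:R :> R by rewrite ltr0n.
apply/andP; split.
  rewrite -(ler_pM2r N0) (le_trans _ i1)// -natrM ler_nat; exact: leq_trunc_div.
rewrite -(ltr_pM2r N0) (lt_le_trans i2)// -natrM ler_nat.
by rewrite ltn_ceil.
Qed.

(** Heights in the profile stay in [0, 1], hence the ranges are nested. *)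
Lemma seg_low_high_refine n x :
  seg_low n x <= seg_low n.+1 x /\ seg_high n.+1 x <= seg_high n x.
Proof.
rewrite /seg_low /seg_high -(truncn_refine n).
have [j [r [rN -> jE]]] := split_index n (Num.truncn (x * (mesh n.+1)%:R)).
rewrite -jE -addnS !node_val_refine// ?(ltnW rN)//.
set u := node_val n j; set v := node_val n j.+1.
have /andP[] := profile01 (ltnW rN); have /andP[] := profile01 rN.
set s := profile _ _; set t := profile _ _ => s0 s1 t0 t1.
have [uv|uv] := leP u v.
  by rewrite le_min !ge_max; split; apply/andP; split; nra.
by rewrite le_min !ge_max; split; apply/andP; split; nra.
Qed.

Lemma seg_low_le_high n x : seg_low n x <= seg_high n x.
Proof. by rewrite /seg_low /seg_high ge_min le_max lexx. Qed.

Lemma seg_low_mono x m n : (m <= n)%N -> seg_low m x <= seg_low n x.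
Proof.
move=> /subnK <-; elim: (n - m)%N => // p /le_trans; apply.
exact: (seg_low_high_refine _ _).1.
Qed.

Lemma seg_high_mono x m n : (m <= n)%N -> seg_high n x <= seg_high m x.
Proof.
move=> /subnK <-; elim: (n - m)%N => // p; apply: le_trans.
exact: (seg_low_high_refine _ _).2.
Qed.

Lemma zigzag_bounds n x : seg_low n x <= zigzag x <= seg_high n x.
Proof.
have lh p : seg_low p x <= seg_high n x.
  apply: le_trans (seg_low_mono x (leq_maxl p n)) (le_trans (seg_low_le_high _ _) _).
  exact: seg_high_mono (leq_maxr p n).
apply/andP; split.
  by apply: ub_le_sup; [exists (seg_high n x) => _ [p _ <-]|exists n].
by apply: ge_sup => [|_ [p _ <-]//]; exists (seg_low n x), n.
Qed.

Lemma node_val_dist n j : `|node_val n j.+1 - node_val n j| <= A * (3 / 4) ^+ n.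
Proof.
have /andP[l u] := node_val_step n j.
have -> : `|node_val n j.+1 - node_val n j| =
    `|(-1) ^+ j * (node_val n j.+1 - node_val n j)|.
  by rewrite normrM normr_sign mul1r.
rewrite ger0_norm//; apply: le_trans l.
by rewrite mulr_ge0 ?exprn_ge0 ?ltW// invr_gt0.
Qed.

Lemma in_node_seg n x : 0 <= x ->
  node n (Num.truncn (x * (mesh n)%:R)) <= x < node n (Num.truncn (x * (mesh n)%:R)).+1.
Proof.
move=> x0; rewrite ler_pdivrMr ?meshR_gt0// ltr_pdivlMr ?meshR_gt0//.
by apply: truncn_itv; rewrite mulr_ge0.
Qed.

Lemma truncn_node_seg n j x : node n j <= x < node n j.+1 ->
  Num.truncn (x * (mesh n)%:R) = j.
Proof.
move=> H; apply: truncn_def.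
by rewrite -ler_pdivrMr ?meshR_gt0// -ltr_pdivlMr ?meshR_gt0.
Qed.

Lemma pow34_small (e : R) : 0 < e -> exists n, A * (3 / 4) ^+ n < e.
Proof.
move=> e0; have q01 : 0 <= (3 / 4 : R) < 1 by lra.
have [n ne] := geometric_small q01 (divr_gt0 e0 A_gt0).
by exists n; rewrite mulrC -ltr_pdivlMr.
Qed.

Lemma zigzag_node n j : zigzag (node n j) = node_val n j.
Proof.
(* A node of mesh n is a node of every finer mesh, with the same value. *)
have lift p : exists i, node (p + n) i = node n j /\ node_val (p + n) i = node_val n j.
  elim: p => [|p [i [<- <-]]]; first by exists j.
  by exists (i * branching (p + n))%N; rewrite nodeS node_valS.
apply/eqP; rewrite -subr_eq0 -normr_le0 leNgt; apply/negP => /pow34_small[p].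
apply/negP; rewrite -leNgt.
have [i [<- <-]] := lift p.
have := zigzag_bounds (p + n) (node (p + n) i).
have iE : Num.truncn (node (p + n) i * (mesh (p + n))%:R) = i.
  by apply: truncn_node_seg; rewrite lexx node_lt/=.
rewrite /seg_low /seg_high iE; have := node_val_dist (p + n) i.
have : A * (3 / 4) ^+ (p + n) <= A * (3 / 4) ^+ p.
  by rewrite ler_pM2l// ler_wiXn2l ?leq_addr//; lra.
set a := A * _; set b := A * _; rewrite !ler_norml minEle maxEle.
by case: (leP (node_val _ i)); lra.
Qed.

Lemma zigzag_seg n j x : node n j <= x <= node n j.+1 ->
  exists2 t, 0 <= t <= 1 &
    zigzag x = node_val n j + (node_val n j.+1 - node_val n j) * t.
Proof.
move=> /andP[jx]; rewrite le_eqVlt => /predU1P[->|xj].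
  by exists 1; [lra|rewrite zigzag_node; ring].
have := zigzag_bounds n x; rewrite /seg_low /seg_high (@truncn_node_seg _ j) ?jx//.
set u := node_val n j; set v := node_val n j.+1.
have uv : v - u != 0.
  apply/eqP => uv; have := node_val_step n j; rewrite -/u -/v uv mulr0.
  have : 0 < A * 2^-1 ^+ n by rewrite mulr_gt0// exprn_gt0; lra.
  lra.
move=> H; exists ((zigzag x - u) / (v - u)); last by rewrite mulrCA divff//; ring.
have [uv'|uv'] := leP u v.
  have p : 0 < v - u by lra.
  move: H; rewrite (min_idPl uv') (max_idPr uv') ler_pdivrMr// ler_pdivlMr//; lra.
have p : v - u < 0 by lra.
by move: H; rewrite (min_idPr (ltW uv')) (max_idPl (ltW uv')) ler_ndivrMr// ler_ndivlMr//; lra.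
Qed.

Lemma zigzag_near n j x : node n j <= x <= node n j.+1 ->
  `|zigzag x - node_val n j| <= A * (3 / 4) ^+ n /\
  `|zigzag x - node_val n j.+1| <= A * (3 / 4) ^+ n.
Proof.
move=> /zigzag_seg[t t01 ->]; have := node_val_dist n j.
set u := node_val n j; set v := node_val n j.+1; set a := A * _ => uv.
have -> : u + (v - u) * t - u = (v - u) * t by ring.
have -> : u + (v - u) * t - v = - ((v - u) * (1 - t)) by ring.
rewrite normrN !normrM (ger0_norm (_ : 0 <= t)) ?(ger0_norm (_ : 0 <= 1 - t)); try lra.
have := normr_ge0 (v - u); set w := `|_| in uv * => w0; split; nra.
Qed.

Lemma zigzag_neg x : x <= 0 -> zigzag x = 0.
Proof.
move=> x0; have <- : zigzag (node 0 0) = 0 by rewrite zigzag_node /= mulr0.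
rewrite /zigzag; suff -> : seg_low^~ x = seg_low^~ (node 0 0) by [].
apply/funext => n; rewrite /seg_low /node mul0r mul0r.
have -> : Num.truncn (x * (mesh n)%:R) = 0%N.
  apply/truncn0Pn; rewrite -ltNge; apply: le_lt_trans ltr01.
  exact: mulr_le0_ge0.
by rewrite truncn0.
Qed.

Lemma zigzag_modulus n x y : `|x - y| < (mesh n)%:R^-1 ->
  `|zigzag x - zigzag y| <= A * (3 / 4) ^+ n *+ 2.
Proof.
have pos u v : 0 <= u -> u <= v -> v - u < (mesh n)%:R^-1 ->
    `|zigzag v - zigzag u| <= A * (3 / 4) ^+ n *+ 2.
  move=> u0 uv d; have /andP[j1 j2] := in_node_seg n u0.
  set j := Num.truncn _ in j1 j2.
  have [_ h] : `|zigzag u - node_val n j| <= A * (3 / 4) ^+ n /\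
     `|zigzag u - node_val n j.+1| <= A * (3 / 4) ^+ n.
    by apply: zigzag_near; rewrite j1 ltW.
  (* v lies in the segment of u or in the next one; both end at node j.+1. *)
  have h' : `|zigzag v - node_val n j.+1| <= A * (3 / 4) ^+ n.
    have [vj|vj] := leP v (node n j.+1).
      by apply: (zigzag_near _).2; rewrite vj (le_trans j1).
    apply: (zigzag_near _).1; rewrite ltW//= node_succ; lra.
  rewrite (_ : zigzag v - zigzag u = zigzag v - node_val n j.+1
     - (zigzag u - node_val n j.+1)); last ring.
  by rewrite (le_trans (ler_normB _ _))// mulr2n lerD.
have all u v : u <= v -> v - u < (mesh n)%:R^-1 ->
    `|zigzag v - zigzag u| <= A * (3 / 4) ^+ n *+ 2.
  move=> uv d; have [u0|u0] := leP 0 u; first exact: pos.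
  have [v0|v0] := leP v 0.
    rewrite (zigzag_neg v0) (zigzag_neg (ltW u0)) subrr normr0.
    by apply: mulrn_wge0; apply: mulr_ge0; [exact: ltW|apply: exprn_ge0; lra].
  rewrite [zigzag u](_ : _ = zigzag 0); last by rewrite (zigzag_neg (ltW u0)) zigzag_neg.
  by apply: pos => //; [exact: ltW|lra].
have [xy|xy] := leP x y => d.
  by rewrite distrC; apply: all => //; move: d; rewrite distrC ger0_norm; lra.
by apply: all => //; [exact: ltW|move: d; rewrite ger0_norm; lra].
Qed.

Lemma zigzag_continuous : continuous zigzag.
Proof.
move=> x; apply/cvgrPdist_le => e e0.
have e2 : 0 < e / 2 by lra.
have [n ne] := pow34_small e2.
have M0 : 0 < (mesh n)%:R^-1 :> R by rewrite invr_gt0 meshR_gt0.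
apply: filterS (nbhsx_ballx x _ M0) => y xy.
by apply: le_trans (zigzag_modulus xy) _; rewrite mulr2n; lra.
Qed.

(** Beyond its first subsegment, a segment stays above one quarter of its
    height, which is what a perturbation cannot compensate. *)
Lemma zigzag_far_left n j x :
  node n.+1 (j * branching n).+1 <= x <= node n j.+1 ->
  A * 2^-1 ^+ n / 4 <= (-1) ^+ j * (zigzag x - node_val n j).
Proof.
have /andP[st _] := node_val_step n j.
have a0 : 0 < A * 2^-1 ^+ n by rewrite mulr_gt0 ?exprn_gt0 ?invr_gt0.
move: st; set a := A * _ in a0 *; set s := (-1) ^+ j => st.
move=> /andP[x1]; rewrite le_eqVlt => /predU1P[->|x2].
  by rewrite zigzag_node; lra.
have x0 : 0 <= x := le_trans (node_ge0 _ _) x1.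
have /andP[i1 i2] := in_node_seg n.+1 x0.
set i := Num.truncn _ in i1 i2.
have ji : (j * branching n < i)%N.
  by have := le_lt_trans x1 i2; rewrite node_lt.
have ij : (i < j * branching n + branching n)%N.
  by have := le_lt_trans i1 x2; rewrite -(nodeS n) node_lt mulSn addnC.
pose r := (i - j * branching n)%N.
have rE : i = (j * branching n + r)%N by rewrite /r; lia.
have rN : (r < branching n)%N by rewrite /r; lia.
have r0 : (0 < r)%N by rewrite /r; lia.
have [t t01 ->] : exists2 t, 0 <= t <= 1 &
   zigzag x = node_val n.+1 i + (node_val n.+1 i.+1 - node_val n.+1 i) * t.
  by apply: zigzag_seg; rewrite i1 ltW.
rewrite rE -addnS !node_val_refine// ?(ltnW rN)//.
have p1 : 4^-1 <= profile (branching n) r by apply: profile_ge; rewrite r0 ltnW.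
have p2 : 4^-1 <= profile (branching n) r.+1 by apply: profile_ge.
move: st; set u := node_val n j; set v := node_val n j.+1.
set p := profile _ r in p1 *; set q := profile _ r.+1 in p2 * => st.
have -> : s * (u + (v - u) * p + (u + (v - u) * q - (u + (v - u) * p)) * t - u)
  = s * (v - u) * (p + (q - p) * t) by ring.
have : 4^-1 <= p + (q - p) * t by nra.
set w := s * _ in st *; set z := p + _ => z4; nra.
Qed.

Lemma zigzag_far_right n j x :
  node n j <= x <= node n.+1 (j * branching n + (branching n).-1) ->
  A * 2^-1 ^+ n / 4 <= (-1) ^+ j * (node_val n j.+1 - zigzag x).
Proof.
have /andP[st _] := node_val_step n j.
have a0 : 0 < A * 2^-1 ^+ n by rewrite mulr_gt0 ?exprn_gt0 ?invr_gt0.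
move: st; set a := A * _ in a0 *; set s := (-1) ^+ j => st.
set v := node_val n j.+1 in st *; set u := node_val n j in st *.
have N1 : ((branching n).-1 < branching n)%N by [].
move=> /andP[x1]; rewrite le_eqVlt => /predU1P[->|x2].
  rewrite zigzag_node node_val_refine// -/u -/v.
  have := profile_le N1; move: (profile _ _) => p p1.
  rewrite (_ : _ * _ = s * (v - u) * (1 - p)); last ring.
  nra.
have x0 : 0 <= x := le_trans (node_ge0 _ _) x1.
have /andP[i1 i2] := in_node_seg n.+1 x0.
set i := Num.truncn _ in i1 i2.
have ji : (j * branching n <= i)%N.
  by have := le_lt_trans x1 i2; rewrite -(nodeS n) node_lt ltnS.
have ij : (i < j * branching n + (branching n).-1)%N.
  by have := le_lt_trans i1 x2; rewrite node_lt.
pose r := (i - j * branching n)%N.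
have rE : i = (j * branching n + r)%N by rewrite /r; lia.
have rN : (r.+1 < branching n)%N by rewrite /r; lia.
have [t t01 ->] : exists2 t, 0 <= t <= 1 &
   zigzag x = node_val n.+1 i + (node_val n.+1 i.+1 - node_val n.+1 i) * t.
  by apply: zigzag_seg; rewrite i1 ltW.
rewrite rE -addnS !node_val_refine// ?(ltnW rN)//; last by rewrite ltnW// ltnW.
have p1 := profile_le (ltnW rN); have p2 := profile_le rN.
rewrite -/u -/v; set p := profile _ r in p1 *; set q := profile _ r.+1 in p2 *.
have -> : s * (v - (u + (v - u) * p + (u + (v - u) * q - (u + (v - u) * p)) * t))
  = s * (v - u) * (1 - (p + (q - p) * t)) by ring.
have : p + (q - p) * t <= 3 / 4 by nra.
set w := s * _ in st *; set z := p + _ => z4; nra.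
Qed.

End zigzag.

(** * Perturbations of the zigzag function *)

Section perturbed.
Context {R : realType}.
Variables (A : R) (k : nat -> nat) (G : R -> R).
Hypothesis A_gt0 : 0 < A.
Hypothesis G_modulus : forall n x y, `|x - y| <= 3 / (mesh k n)%:R ->
  `|G x - G y| <= A * 2^-1 ^+ n / 16.

Local Notation node := (@node R k).
Local Notation zigzag := (zigzag A k).
Local Notation val := (node_val A k).
Local Notation M := (mesh k).
Local Notation N := (branching k).

Definition perturbed (x : R) := zigzag x + G x.
Local Notation h := perturbed.

Let amp_gt0 n : 0 < A * 2^-1 ^+ n.
Proof. by rewrite mulr_gt0 ?exprn_gt0 ?invr_gt0. Qed.

Let ampS n : A * 2^-1 ^+ n.+1 = A * 2^-1 ^+ n / 2.
Proof. by rewrite exprSr mulrA. Qed.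

Let sign_cases i : ((-1) ^+ i = 1 :> R) \/ ((-1) ^+ i = -1 :> R).
Proof. by rewrite -signr_odd; case: odd; [right|left]. Qed.

Lemma perturbed_continuous : continuous h.
Proof.
move=> x; apply: cvgD; first exact: (zigzag_continuous A_gt0).
apply/cvgrPdist_le => e e0.
have q01 : 0 <= (2^-1 : R) < 1 by lra.
have [n] := geometric_small q01 (divr_gt0 e0 A_gt0).
rewrite ltr_pdivlMr// mulrC => ne.
have M0 : 0 < 3 / (M n)%:R :> R by rewrite divr_gt0// meshR_gt0.
apply: filterS (nbhsx_ballx x _ M0) => y xy.
have := G_modulus (ltW xy); have := amp_gt0 n.
by set a := A * _ in ne * => a0 /le_trans; apply; lra.
Qed.

Lemma perturbation_dist_node n i j : (j <= i + 3)%N -> (i <= j + 3)%N ->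
  `|G (node n i) - G (node n j)| <= A * 2^-1 ^+ n / 16.
Proof.
move=> ij ji; apply: G_modulus; rewrite !nodeE -mulrBl normrM.
rewrite (ger0_norm (_ : 0 <= (M n)%:R^-1)) ?invr_ge0//.
rewrite ler_pM2r ?invr_gt0 ?meshR_gt0// ler_norml.
have : (j%:R <= (i + 3)%:R :> R) by rewrite ler_nat.
have : (i%:R <= (j + 3)%:R :> R) by rewrite ler_nat.
by rewrite !natrD; lra.
Qed.

Lemma perturbation_dist_seg n j x y : node n j <= x <= node n j.+1 ->
  node n j <= y <= node n j.+1 -> `|G x - G y| <= A * 2^-1 ^+ n / 16.
Proof.
have M0 : 0 < (M n)%:R^-1 :> R by rewrite invr_gt0 meshR_gt0.
rewrite node_succ => xj yj; apply: G_modulus.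
by rewrite ler_norml; lra.
Qed.

Lemma leq_mesh m n : (m <= n)%N -> (M m <= M n)%N.
Proof.
move=> /subnK <-; elim: (n - m)%N => // p /leq_trans; apply.
by rewrite /= leq_pmulr.
Qed.

Lemma small_inv_mesh n (e : R) : 0 < e -> exists p, (M (n + p)%N)%:R^-1 < e.
Proof.
move=> e0; have [p pe] := inv_mesh_small k e0; exists p.
apply: le_lt_trans pe; rewrite -[leLHS]mul1r; apply: ler_pM; rewrite ?invr_ge0//; first lra.
by rewrite lef_pV2 ?posrE ?meshR_gt0// ler_nat leq_mesh ?leq_addl.
Qed.

Lemma nodeS_last n j : node n.+1 (j * N n + (N n).-1).+1 = node n j.+1.
Proof. by rewrite -(nodeS k n j.+1) mulSn addnC -addSn. Qed.

Lemma sign_sub_first n j : (-1) ^+ (j * N n) = (-1) ^+ j :> R.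
Proof. by rewrite -[X in _ ^+ X]addn0 sign_refine mulr1. Qed.

Lemma sign_sub_last n j : (-1) ^+ (j * N n + (N n).-1) = (-1) ^+ j :> R.
Proof. by rewrite sign_refine -(signr_odd _ (N n).-1) /= negbK odd_double mulr1. Qed.

Lemma perturbed_far_left n j x :
  node n.+1 (j * N n).+1 <= x <= node n j.+1 ->
  (-1) ^+ j * h (node n j) < (-1) ^+ j * h x.
Proof.
move=> xseg; have := zigzag_far_left A_gt0 xseg.
have /andP[xf xj] := xseg.
have jn : node n j <= node n j <= node n j.+1 by rewrite lexx node_le leqnSn.
have xn : node n j <= x <= node n j.+1.
  by rewrite xj (le_trans _ xf)// -(nodeS k n j) node_le leqnSn.
have := perturbation_dist_seg jn xn; rewrite ler_norml /perturbed zigzag_node//.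
by have := amp_gt0 n; case: (sign_cases j) => ->; lra.
Qed.

Lemma perturbed_far_right n j x :
  node n j <= x <= node n.+1 (j * N n + (N n).-1) ->
  (-1) ^+ j * h x < (-1) ^+ j * h (node n j.+1).
Proof.
move=> xseg; have := zigzag_far_right A_gt0 xseg.
have /andP[xj xf] := xseg.
have jn : node n j <= node n j.+1 <= node n j.+1 by rewrite lexx node_le leqnSn.
have xn : node n j <= x <= node n j.+1.
  by rewrite xj (le_trans xf)// -nodeS_last node_le leqnSn.
have := perturbation_dist_seg jn xn; rewrite ler_norml /perturbed zigzag_node//.
by have := amp_gt0 n; case: (sign_cases j) => ->; lra.
Qed.

(** If x lies in the first subsegment, replace the segment by it, which starts
    at the same node and has the same direction.  As x differs from that node,
    x eventually lies beyond the first subsegment, where the gain of one quarter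
    of the height beats the oscillation of G. *)
Lemma perturbed_gt_left n j x : node n j < x <= node n j.+1 ->
  (-1) ^+ j * h (node n j) < (-1) ^+ j * h x.
Proof.
have claim p : forall n j x,
    node n j + (M (n + p)%N)%:R^-1 <= x -> x <= node n j.+1 ->
    (-1) ^+ j * h (node n j) < (-1) ^+ j * h x.
  elim: p => [|p IH] {}n {}j {}x jx xj.
    apply: perturbed_far_left; rewrite xj andbT (le_trans _ jx)//.
    rewrite addn0 -node_succ -(nodeS k n j.+1) node_le mulSn -addn1 addnC.
    by rewrite leq_add2r.
  have [xf|xf] := leP (node n.+1 (j * N n).+1) x.
    by apply: perturbed_far_left; rewrite xf.
  have := IH n.+1 (j * N n)%N x; rewrite sign_sub_first nodeS.
  by apply; [rewrite addSnnS|exact: ltW].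
move=> /andP[jx xj]; have jx' : 0 < x - node n j by lra.
have [p pe] := small_inv_mesh n jx'.
by apply: (claim p) => //; lra.
Qed.

Lemma perturbed_lt_right n j x : node n j <= x < node n j.+1 ->
  (-1) ^+ j * h x < (-1) ^+ j * h (node n j.+1).
Proof.
have claim p : forall n j x,
    node n j <= x -> x <= node n j.+1 - (M (n + p)%N)%:R^-1 ->
    (-1) ^+ j * h x < (-1) ^+ j * h (node n j.+1).
  elim: p => [|p IH] {}n {}j {}x jx xj.
    apply: perturbed_far_right; rewrite jx/= (le_trans xj)//.
    by rewrite addn0 node_succ addrK -(nodeS k n j) node_le leq_addr.
  have [xf|xf] := leP x (node n.+1 (j * N n + (N n).-1)).
    by apply: perturbed_far_right; rewrite xf jx.
  have := IH n.+1 (j * N n + (N n).-1)%N x; rewrite sign_sub_last nodeS_last.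
  by apply; [exact: ltW|rewrite addSnnS].
move=> /andP[jx xj]; have xj' : 0 < node n j.+1 - x by lra.
have [p pe] := small_inv_mesh n xj'.
by apply: (claim p) => //; lra.
Qed.

Lemma perturbed_IVT (a b y : R) : a <= b ->
  Num.min (h a) (h b) <= y <= Num.max (h a) (h b) ->
  exists2 c, a <= c <= b & h c = y.
Proof.
move=> ab yab; have [|c] := IVT ab _ yab.
  by apply: continuous_subspaceT; exact: perturbed_continuous.
by rewrite in_itv; exists c.
Qed.

(** Otherwise the neighbouring segment, on which h runs back, would contain
    another solution of h y = h x by the intermediate value theorem. *)
Lemma perturbed_isolated_near n x :
  (forall y, y != x -> `|x - y| < 2 / (M n)%:R -> h y != h x) ->
  forall m i, (n <= m)%N -> node m i < x < node m i.+1 ->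
  (-1) ^+ i * h x <= (-1) ^+ i * h (node m i.+2) /\
  ((0 < i)%N -> (-1) ^+ i * h (node m i.-1) <= (-1) ^+ i * h x).
Proof.
move=> iso m i nm /andP[ix xi].
have near y : `|x - y| < 2 / (M m)%:R -> h y = h x -> y = x.
  move=> xy hyx; apply/eqP; apply: contraT => /iso; rewrite hyx eqxx; apply.
  apply: lt_le_trans xy _; rewrite ler_pM2l//.
  by rewrite lef_pV2 ?posrE ?meshR_gt0// ler_nat leq_mesh.
have M0 : 0 < (M m)%:R^-1 :> R by rewrite invr_gt0 meshR_gt0.
have l : (-1) ^+ i * h (node m i) < (-1) ^+ i * h x.
  by apply: perturbed_gt_left; rewrite ix ltW.
have r : (-1) ^+ i * h x < (-1) ^+ i * h (node m i.+1).
  by apply: perturbed_lt_right; rewrite xi ltW.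
split=> [|i0]; rewrite leNgt; apply/negP => bad.
  have [||y] := @perturbed_IVT (node m i.+1) (node m i.+2) (h x).
  - by rewrite node_le.
  - rewrite ge_min le_max; move: bad r; case: (sign_cases i) => ->; rewrite ?mul1r ?mulN1r.
      by move=> /ltW -> /ltW ->; rewrite orbT.
    by rewrite !ltrN2 => /ltW -> /ltW ->; rewrite orbT.
  move=> ys /near ye.
  have : y = x by apply: ye; move: ys ix xi; rewrite ltr_norml !node_succ; lra.
  by lra.
case: i i0 ix xi l r bad => //= i _ ix xi l r bad.
have [||y] := @perturbed_IVT (node m i) (node m i.+1) (h x).
- by rewrite node_le.
- rewrite ge_min le_max; move: bad l; case: (sign_cases i.+1) => ->; rewrite ?mul1r ?mulN1r.
    by move=> /ltW -> /ltW ->; rewrite orbT.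
  by rewrite !ltrN2 => /ltW -> /ltW ->; rewrite orbT.
move=> ys /near ye.
have : y = x by apply: ye; move: ys ix xi; rewrite ltr_norml !node_succ; lra.
by lra.
Qed.

(** For an inner subsegment the two inequalities of [perturbed_isolated_near]
    contradict each other, as the swing of the profile exceeds the oscillation
    of G. *)
Lemma perturbed_swing n j r : (0 < r)%N -> (r.+2 <= N n)%N ->
  (-1) ^+ (j * N n + r) * h (node n.+1 (j * N n + r).+2) <
  (-1) ^+ (j * N n + r) * h (node n.+1 (j * N n + r).-1).
Proof.
move=> r0 rN; set i := (j * N n + r)%N.
have iE : i.-1 = (j * N n + r.-1)%N by rewrite /i; lia.
have := @perturbation_dist_node n.+1 i.-1 i.+2; rewrite ler_norml.
move=> /(_ _ _)/andP[||]; try lia.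
move=> g1 g2; rewrite /perturbed !zigzag_node// iE /i -addnS -addnS.
rewrite !node_val_refine ?sign_refine//; last lia.
have sw := profile_swing (branching_odd k n) r0 rN.
have /andP[st _] := node_val_step k A_gt0 n j.
have := ler_pM (ltW (amp_gt0 n)) (_ : 0 <= 2^-1) st (sw R).
move: g1 g2 (amp_gt0 n); rewrite iE /i -!addnS ampS invr_ge0.
set a := A * _; set u := val n j; set v := val n j.+1.
set p := profile _ r.-1; set q := profile _ r.+2.
set g := G _; set g' := G _ => g1 g2 a0 /(_ (ler0n _ 2)).
by case: (sign_cases j) => ->; case: (sign_cases r) => ->; lra.
Qed.

Let height_at (u v t : R) := u + (v - u) * t.

Let node_val_1 n j : val n.+1 (j * N n).+1 = height_at (val n j) (val n j.+1) (3 / 4).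
Proof. by rewrite -[(j * N n).+1]addn1 node_val_refine. Qed.

Let node_val_2 n j : val n.+1 (j * N n).+2 = height_at (val n j) (val n j.+1) (1 / 4).
Proof. by rewrite -[(j * N n).+2]addn2 node_val_refine. Qed.

Let node_val_last1 n j :
  val n.+1 (j * N n + (N n).-1) = height_at (val n j) (val n j.+1) (1 / 4).
Proof.
by rewrite node_val_refine ?leq_pred// profile_in//= negbK odd_double.
Qed.

Let node_val_last2 n j :
  val n.+1 (j * N n + (N n).-1).-1 = height_at (val n j) (val n j.+1) (3 / 4).
Proof.
rewrite (_ : _.-1 = j * N n + (N n).-2)%N; last first.
  by have := branching_gt2 k n; move: (N _) (j * _)%N => q p; lia.
rewrite node_val_refine ?profile_in//= ?odd_double// /branching.
by rewrite -addnn; lia.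
Qed.

(** The upper bound that comes from lying in a first subsegment (a quarter of
    the height) contradicts the lower bound that comes from lying in the last
    subsegment of that one (three quarters of three quarters). *)
Lemma perturbed_first_last n j :
  (-1) ^+ j * h (node n.+1 (j * N n).+2) <
  (-1) ^+ j * h (node n.+2 (j * N n * N n.+1 + (N n.+1).-1).-1).
Proof.
set i := (j * N n)%N; set i' := (i * N n.+1 + (N n.+1).-1)%N.
have g1 : `|G (node n.+2 i'.-1) - G (node n.+1 i.+1)| <= A * 2^-1 ^+ n / 32.
  have -> : A * 2^-1 ^+ n / 32 = A * 2^-1 ^+ n.+1 / 16 by rewrite ampS; field.
  apply: (@perturbation_dist_seg _ i); rewrite ?lexx ?node_le ?leqnSn//.
  rewrite -!(nodeS k n.+1) !node_le /i' mulSn.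
  have := branching_gt2 k n.+1; move: (N _) (i * _)%N => q p; lia.
have g2 : `|G (node n.+1 i.+1) - G (node n.+1 i.+2)| <= A * 2^-1 ^+ n / 32.
  have -> : A * 2^-1 ^+ n / 32 = A * 2^-1 ^+ n.+1 / 16 by rewrite ampS; field.
  by apply: perturbation_dist_node; lia.
have /andP[+ _] := node_val_step k A_gt0 n j.
move: g1 g2 (amp_gt0 n); rewrite !ler_norml /perturbed !zigzag_node//.
rewrite node_val_last2 node_val_2 node_val_1 node_valS /height_at.
by set a := A * _; case: (sign_cases j) => ->; lra.
Qed.

(** Symmetrically to [perturbed_first_last], here 7/16 of the height is below
    3/4 of it. *)
Lemma perturbed_last_first n j :
  (-1) ^+ j * h (node n.+2 ((j * N n + (N n).-1) * N n.+1).+2) <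
  (-1) ^+ j * h (node n.+1 (j * N n + (N n).-1).-1).
Proof.
set i := (j * N n + (N n).-1)%N.
have N3 := branching_gt2 k n.+1.
have i0 : (0 < i)%N by rewrite /i; have := branching_gt2 k n; lia.
have g1 : `|G (node n.+2 (i * N n.+1).+2) - G (node n.+1 i)| <= A * 2^-1 ^+ n / 32.
  have -> : A * 2^-1 ^+ n / 32 = A * 2^-1 ^+ n.+1 / 16 by rewrite ampS; field.
  apply: (@perturbation_dist_seg _ i); rewrite ?lexx ?node_le ?leqnSn//.
  rewrite -!(nodeS k n.+1) !node_le mulSn.
  by move: N3; move: (N _) (i * _)%N => q p; lia.
have g2 : `|G (node n.+1 i) - G (node n.+1 i.-1)| <= A * 2^-1 ^+ n / 32.
  have -> : A * 2^-1 ^+ n / 32 = A * 2^-1 ^+ n.+1 / 16 by rewrite ampS; field.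
  by apply: perturbation_dist_node; lia.
have /andP[+ _] := node_val_step k A_gt0 n j.
move: g1 g2 (amp_gt0 n); rewrite !ler_norml /perturbed !zigzag_node//.
have last : val n.+1 i.+1 = val n j.+1.
  by rewrite /i -addnS node_val_refine// profileN// /= mulr1 addrC subrK.
rewrite node_val_2 last node_val_last1 node_val_last2 /height_at.
by set a := A * _; case: (sign_cases j) => ->; lra.
Qed.

(** If x were isolated in its level set, then in all fine meshes it would lie
    in the first or in the last subsegment of its segment, always in the first
    or always in the last by [perturbed_first_last] and [perturbed_last_first];
    so x would be an end of all these segments, hence a node. *)
Lemma perturbed_not_isolated x e : 0 < x -> (forall n j, x != node n j) -> 0 < e ->
  exists y, [/\ y != x, `|x - y| < e & h y = h x].
Proof.
move=> x0 nx e0; apply: contrapT => noy.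
have [n0 n0e] := inv_mesh_small k e0.
have iso y : y != x -> `|x - y| < 2 / (M n0)%:R -> h y != h x.
  move=> yx xy; apply/eqP => hyx; apply: noy; exists y; split => //.
  apply: lt_trans n0e; apply: lt_le_trans xy _.
  by rewrite ler_pM2r ?invr_gt0 ?meshR_gt0//; lra.
(* idx n is the segment of mesh n that contains x. *)
pose idx n := Num.truncn (x * (M n)%:R).
have seg n : node n (idx n) < x < node n (idx n).+1.
  have /andP[l ->] := in_node_seg k n (ltW x0).
  by rewrite andbT lt_neqAle eq_sym nx.
have bad m : (n0 <= m)%N ->
  (-1) ^+ (idx m) * h x <= (-1) ^+ (idx m) * h (node m (idx m).+2) /\
  ((0 < idx m)%N -> (-1) ^+ (idx m) * h (node m (idx m).-1) <= (-1) ^+ (idx m) * h x).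
  by move=> n0m; exact: (perturbed_isolated_near iso).
have idxS n : (n0 <= n)%N ->
    idx n.+1 = (idx n * N n)%N \/ idx n.+1 = (idx n * N n + (N n).-1)%N.
  move=> n0n; have [j [r [rN iE jE]]] := split_index k n (idx n.+1).
  have {}jE : j = idx n by rewrite jE truncn_refine.
  have [r0|r0] := posnP r; first by left; rewrite iE r0 addn0 jE.
  have [rL|rL] := eqVneq r (N n).-1; first by right; rewrite iE rL jE.
  have r2 : (r.+2 <= N n)%N by have := branching_gt2 k n; lia.
  have [U L] := bad n.+1 (leqW n0n).
  have i0 : (0 < idx n.+1)%N by rewrite iE addn_gt0 r0 orbT.
  have := le_trans (L i0) U; rewrite leNgt iE.
  by rewrite perturbed_swing.
have first p : idx n0.+1 = (idx n0 * N n0)%N ->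
    idx (n0 + p).+1%N = (idx (n0 + p)%N * N (n0 + p))%N.
  move=> base; elim: p => [|p IH]; first by rewrite addn0.
  rewrite addnS; set n := (n0 + p)%N in IH *.
  have n0n : (n0 <= n)%N := leq_addr _ _.
  case: (idxS n.+1 (leqW n0n)) => // lst.
  have [U _] := bad n.+1 (leqW n0n).
  have [_] := bad n.+2 (leqW (leqW n0n)).
  have s1 : (-1) ^+ idx n.+1 = (-1) ^+ idx n :> R by rewrite IH sign_sub_first.
  have s2 : (-1) ^+ idx n.+2 = (-1) ^+ idx n :> R by rewrite lst sign_sub_last.
  have i0 : (0 < idx n.+2)%N.
    by rewrite lst addn_gt0; have := branching_gt2 k n.+1; lia.
  move=> /(_ i0) L; have := perturbed_first_last n (idx n); rewrite -IH -lst.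
  by move: U L; rewrite s1 s2 => U L; rewrite ltNge (le_trans L U).
have last p : idx n0.+1 = (idx n0 * N n0 + (N n0).-1)%N ->
    idx (n0 + p).+1%N = (idx (n0 + p)%N * N (n0 + p) + (N (n0 + p)).-1)%N.
  move=> base; elim: p => [|p IH]; first by rewrite addn0.
  rewrite addnS; set n := (n0 + p)%N in IH *.
  have n0n : (n0 <= n)%N := leq_addr _ _.
  case: (idxS n.+1 (leqW n0n)) => // fst.
  have [_ L] := bad n.+1 (leqW n0n).
  have [U _] := bad n.+2 (leqW (leqW n0n)).
  have s1 : (-1) ^+ idx n.+1 = (-1) ^+ idx n :> R by rewrite IH sign_sub_last.
  have s2 : (-1) ^+ idx n.+2 = (-1) ^+ idx n :> R by rewrite fst sign_sub_first.
  have i0 : (0 < idx n.+1)%N.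
    by rewrite IH addn_gt0; have := branching_gt2 k n; lia.
  move: L => /(_ i0) L; have := perturbed_last_first n (idx n); rewrite -IH -fst.
  by move: U L; rewrite s1 s2 => U L; rewrite ltNge (le_trans L U).
have [base|base] := idxS n0 (leqnn n0).
  have const p : node (n0 + p)%N (idx (n0 + p)%N) = node n0 (idx n0).
    elim: p => [|p IH]; first by rewrite addn0.
    by rewrite addnS first// nodeS.
  have gap : 0 < x - node n0 (idx n0) by have := seg n0; lra.
  have [p pe] := small_inv_mesh n0 gap.
  by have := seg (n0 + p)%N; rewrite node_succ const; lra.
have const p : node (n0 + p)%N (idx (n0 + p)%N).+1 = node n0 (idx n0).+1.
  elim: p => [|p IH]; first by rewrite addn0.
  by rewrite addnS last// nodeS_last.
have gap : 0 < node n0 (idx n0).+1 - x by have := seg n0; lra.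
have [p pe] := small_inv_mesh n0 gap.
have := @node_succ R k (n0 + p)%N (idx (n0 + p)%N); rewrite const => e1.
by have /andP[] := seg (n0 + p)%N; lra.
Qed.

End perturbed.

(** * Level sets of the perturbed zigzag function *)

Section levels.
Context {R : realType}.
Variables (A : R) (k : nat -> nat) (G : R -> R).
Hypothesis A_gt0 : 0 < A.
Hypothesis G_modulus : forall n x y, `|x - y| <= 3 / (mesh k n)%:R ->
  `|G x - G y| <= A * 2^-1 ^+ n / 16.

Local Notation node := (@node R k).
Local Notation h := (perturbed A k G).
Local Notation M := (mesh k).

Lemma node_between (a b : R) : 0 <= a -> a < b -> exists n j, a < node n j < b.
Proof.
move=> a0 ab; have ab' : 0 < b - a by lra.
have [n nab] := inv_mesh_small k ab'.
have M0 : 0 < (M n)%:R^-1 :> R by rewrite invr_gt0 meshR_gt0.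
have := in_node_seg k n a0; set j := Num.truncn _ => /andP[ja aj].
by exists n, j.+1; rewrite aj /=; move: ja; rewrite node_succ; lra.
Qed.

Lemma node0 n : node n 0 = 0. Proof. by rewrite nodeE mul0r. Qed.

Lemma node_mesh n : node n (M n) = 1.
Proof. by rewrite nodeE divff// gt_eqF// meshR_gt0. Qed.

Lemma perturbed_min x : 0 < x <= 1 -> h 0 < h x.
Proof.
have := perturbed_gt_left A_gt0 G_modulus (n := 0) (j := 0) (x := x).
by rewrite (node_mesh 0) node0 !expr0 !mul1r.
Qed.

Lemma perturbed_max x : 0 <= x < 1 -> h x < h 1.
Proof.
have := perturbed_lt_right A_gt0 G_modulus (n := 0) (j := 0) (x := x).
by rewrite (node_mesh 0) node0 !expr0 !mul1r.
Qed.

Lemma node_isolated n j x : `|x - node n j| < (M n)%:R^-1 -> h x = h (node n j) ->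
  0 <= x -> x = node n j.
Proof.
move=> xj hx x0; have [xlt|xgt|//] := ltrgtP x (node n j).
  case: j xlt xj hx => [|j] xlt xj hx; first by move: xlt; rewrite node0; lra.
  have : (-1) ^+ j * h x < (-1) ^+ j * h (node n j.+1).
    apply: perturbed_lt_right => //; rewrite xlt andbT.
    by move: xj; rewrite ltr_norml node_succ; lra.
  by rewrite hx ltxx.
have : (-1) ^+ j * h (node n j) < (-1) ^+ j * h x.
  apply: perturbed_gt_left => //; rewrite xgt /=.
  by move: xj; rewrite ltr_norml node_succ; lra.
by rewrite hx ltxx.
Qed.

(** Since the two segments at an inner node run in opposite directions, a local
    minimum is exceeded on its left, whereas h starts at its absolute minimum 0;
    the level is thus reached before the node.  A local maximum is reached again
    after the node, on the way to the absolute maximum at 1. *)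
Lemma node_level_other n j : 0 < node n j < 1 ->
  exists x, [/\ 0 <= x <= 1, x != node n j & h x = h (node n j)].
Proof.
move=> /andP[c0' c1'].
have : node n 0 < node n j by rewrite node0.
have : node n j < node n (M n) by rewrite node_mesh.
rewrite !node_lt; case: j {c0' c1'} => // j jM _.
have c0 := @node_ge0 R k n j.
have c1 : node n j.+2 <= 1 by rewrite -(node_mesh n) node_le.
have l01 : node n j < node n j.+1 by rewrite node_lt.
have l12 : node n j.+1 < node n j.+2 by rewrite node_lt.
have below : (-1) ^+ j * h (node n j) < (-1) ^+ j * h (node n j.+1).
  by apply: perturbed_lt_right; rewrite ?lexx.
have above : (-1) ^+ j.+1 * h (node n j.+1) < (-1) ^+ j.+1 * h (node n j.+2).
  by apply: perturbed_gt_left; rewrite ?l12 ?lexx.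
have hmin : h 0 < h (node n j.+1) by apply: perturbed_min; lra.
have hmax : h (node n j.+1) < h 1 by apply: perturbed_max; lra.
move: below above; rewrite exprS -signr_odd.
case: odd; rewrite /= ?expr0 ?expr1 ?mulr1 ?mulrNN ?mul1r ?mulN1r => below above.
  (* j odd: h decreases before the node, which is a local minimum. *)
  have [|x x01 hx] := perturbed_IVT A_gt0 G_modulus c0 (y := h (node n j.+1)).
    by rewrite ge_min le_max (ltW hmin)/=; apply/orP; right; lra.
  exists x; split => //; first lra.
  by rewrite lt_eqF//; lra.
(* j even: the node is a local maximum. *)
have [|x x01 hx] := perturbed_IVT A_gt0 G_modulus c1 (y := h (node n j.+1)).
  by rewrite ge_min le_max (ltW hmax) orbT andbT; apply/orP; left; lra.
exists x; split => //; first lra.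
by rewrite gt_eqF//; lra.
Qed.

Implicit Type f : C01 R.

Lemma closed_level f y : closed (f @^-1` [set y]).
Proof.
apply: closed_comp; last exact: closed_eq.
by move=> x _; exact: C01_continuous.
Qed.

Lemma dist_continuous (c : R) : continuous (fun u : unit_interval R => `|set_val u - c|).
Proof.
move=> u; apply: (@cvg_norm R R _ (nbhs u)); apply: (@cvgB R R _ (nbhs u)).
  exact: initial_continuous.
exact: cvg_cst.
Qed.

(** The sets C of interest are a level set, or a level set without its node;
    the last hypothesis, that C is open in the level set, keeps the points of C
    from becoming isolated.  Avoiding the nodes makes C nowhere dense. *)
Lemma is_cantor_level f y (C : set (unit_interval R)) :
  (forall u, f u = h (set_val u)) ->
  min_value f < y < max_value f -> C !=set0 -> closed C ->
  C `<=` f @^-1` [set y] ->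
  (forall u n j, C u -> set_val u != node n j) ->
  (forall u, C u -> exists2 d, 0 < d &
     forall v, f v = y -> `|set_val u - set_val v| < d -> C v) ->
  is_cantor_set C.
Proof.
move=> fh ymM C0 cC Cy Cnode Copen.
have ends := @unit_bounds R.
apply: is_cantor_setP => // [u e Cu e0|u v uv].
- have [d d0 Cd] := Copen u Cu.
  have u0 : 0 < set_val u.
    have := Cnode u 0 0 Cu; rewrite node0 lt_neqAle eq_sym.
    by have /andP[-> _] := ends u; rewrite andbT.
  have u1 : set_val u < 1.
    have := Cnode u 0 (M 0) Cu; rewrite node_mesh lt_neqAle.
    by have /andP[_ ->] := ends u; rewrite andbT.
  (* The last two bounds keep the new point in the unit interval. *)
  pose r := Num.min (Num.min e d) (Num.min (set_val u) (1 - set_val u)).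
  have r0 : 0 < r by rewrite !lt_min e0 d0 u0 subr_gt0.
  have [z [zu]] := perturbed_not_isolated A_gt0 G_modulus u0 (fun n j => Cnode u n j Cu) r0.
  rewrite !lt_min => /andP[/andP[ze zd] /andP[zl zr]] hz.
  have z01 : z \in `[0, 1]%classic.
    by rewrite inE /= in_itv /=; move: zl zr; rewrite !ltr_norml; lra.
  exists (SigSub z01); split; last exact: ze.
    apply: Cd; last exact: zd.
    by rewrite fh /= hz -fh; exact: Cy.
  by apply: contra_neq zu => <-.
- have /andP[u0 _] := ends u; have [n [j uvj]] := node_between u0 uv.
  have j01 : node n j \in `[0, 1]%classic.
    by rewrite inE /= in_itv /=; have := ends v; lra.
  exists (SigSub j01) => //; by move=> /(Cnode _ n j); rewrite eqxx.
Qed.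

Definition node_image : set R :=
  [set y | exists n j, 0 < node n j < 1 /\ y = h (node n j)].

Lemma countable_node_image : countable node_image.
Proof.
apply: (@sub_countable _ _ _ (range (fun p : nat * nat => h (node p.1 p.2)))).
  by apply: subset_card_le => _ [n [j [_ ->]]]; exists (n, j).
exact: sub_countable (card_image_le _ _) (countableP _).
Qed.

(** The exceptional values are those at the inner nodes, each of which is
    taken at exactly one node, by the second hypothesis. *)
Lemma bruckner_garg_perturbed f :
  (forall u, f u = h (set_val u)) ->
  (forall n i m j, 0 < node n i < 1 -> 0 < node m j < 1 ->
     h (node n i) = h (node m j) -> node n i = node m j) ->
  bruckner_garg f.
Proof.
move=> fh inj.
have ends := @unit_bounds R.
have in01 x : 0 <= x <= 1 -> x \in `[0 : R, 1]%classic by rewrite inE /= in_itv.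
have zero01 : 0 <= (0 : R) <= 1 by lra.
have one01 : 0 <= (1 : R) <= 1 by lra.
have fmin : min_value f = h 0.
  have [c fc cmin] := min_valueP f.
  have := cmin (SigSub (in01 _ zero01)); rewrite fh /= -fc fh leNgt => nlt.
  have [->//|c0] := eqVneq (set_val c) 0.
  case/negP: nlt; apply: perturbed_min.
  by rewrite lt_neqAle eq_sym c0 /=; exact: ends.
have fmax : max_value f = h 1.
  have [c fc cmax] := max_valueP f.
  have := cmax (SigSub (in01 _ one01)); rewrite fh /= -fc fh leNgt => nlt.
  have [->//|c0] := eqVneq (set_val c) 1.
  case/negP: nlt; apply: perturbed_max.
  by rewrite lt_neqAle c0 /=; have /andP[-> ->] := ends c.
have interior x : 0 < x < 1 -> h 0 < h x < h 1.
  by move=> x01; rewrite perturbed_min ?perturbed_max//; lra.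
have solve y : h 0 < y < h 1 -> exists2 x, 0 < x < 1 & h x = y.
  move=> y01; have [|x x01 hx] := perturbed_IVT A_gt0 G_modulus ler01 (y := y).
    by rewrite ge_min le_max; apply/andP; split; apply/orP; [left|right]; lra.
  exists x => //; rewrite !lt_neqAle.
  have xn0 : x != 0 by apply/eqP => xE; move: y01; rewrite -hx xE ltxx.
  have xn1 : x != 1 by apply/eqP => xE; move: y01; rewrite -hx xE ltxx andbF.
  by rewrite eq_sym xn0 xn1.
exists node_image; rewrite fmin fmax; split.
- exact: countable_node_image.
- by move=> _ [n [j [/interior j01 ->]]]; rewrite /= in_itv.
- move=> y; rewrite /= in_itv /= => /solve[x x01 hx] B yB.
  have /nbhs_ballP[e e0 eB] : nbhs x (h @^-1` B).
    by apply: perturbed_continuous => //; rewrite hx.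
  have xm : x < Num.min (x + e) 1 by rewrite lt_min ltrDl (e0 : 0 < (e : R)) /=; lra.
  have x0 : 0 <= x by lra.
  have [n [j]] := node_between x0 xm; rewrite lt_min => /and3P[j1 j2 j3].
  exists (h (node n j)); split; first by exists n, j; split => //; lra.
  by apply: eB; rewrite /ball /= ltr_norml; lra.
split.
- move=> y [->|->].
    exists (SigSub (in01 _ zero01)); apply/seteqP.
    split => [u /= fu|_ -> /=]; last by rewrite fh.
    apply: val_inj => /=; apply/eqP; apply: contraT => u0.
    suff : h 0 < h (set_val u) by rewrite -fh fu ltxx.
    apply: perturbed_min => //.
    by rewrite lt_neqAle eq_sym u0 /=; exact: ends.
  exists (SigSub (in01 _ one01)); apply/seteqP.
  split => [u /= fu|_ -> /=]; last by rewrite fh.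
  apply: val_inj => /=; apply/eqP; apply: contraT => u0.
  suff : h (set_val u) < h 1 by rewrite -fh fu ltxx.
  apply: perturbed_max => //.
  by rewrite lt_neqAle u0 /=; have /andP[-> ->] := ends u.
- move=> y [/=]; rewrite in_itv /= => y01 nD.
  apply: (@is_cantor_level f y) => //; rewrite ?fmin ?fmax//.
  + have [x x01 hx] := solve _ y01.
    have x01' : 0 <= x <= 1 by lra.
    by exists (SigSub (in01 _ x01')); rewrite /= fh.
  + exact: closed_level.
  + move=> u n j /= fu; apply/eqP => uE; apply: nD; exists n, j.
    rewrite -uE -fh fu; split => //.
    have u01 := ends u; rewrite !lt_neqAle.
    have un0 : set_val u != 0 by apply/eqP => xE; move: y01; rewrite -fu fh xE ltxx.
    have un1 : set_val u != 1 by apply/eqP => xE; move: y01; rewrite -fu fh xE ltxx andbF.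
    by rewrite eq_sym un0 un1.
  + by move=> u _; exists 1 => // v.
- move=> _ [n [j [c01 ->]]]; set c := node n j in c01 *.
  have c01' : 0 <= c <= 1 by lra.
  pose cu : unit_interval R := SigSub (in01 _ c01').
  (* c is the only point of its level set at distance less than 1 / M n. *)
  pose C := [set u : unit_interval R | f u = h c /\ (M n)%:R^-1 <= `|set_val u - c|].
  have M0 : 0 < (M n)%:R^-1 :> R by rewrite invr_gt0 meshR_gt0.
  have far (u : unit_interval R) :
      f u = h c -> set_val u != c -> (M n)%:R^-1 <= `|set_val u - c|.
    move=> fu uc; rewrite leNgt; apply: contra_neqN uc => uc.
    apply: node_isolated uc _ _; first by rewrite -fh.
    by have /andP[] := ends u.
  have Cc u : C u -> set_val u != c.
    by move=> [_]; apply: contraTneq => ->; rewrite subrr normr0 -ltNge.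
  exists C, cu; split.
  + apply: (@is_cantor_level f (h c)) => //.
    * by rewrite fmin fmax; exact: interior.
    * have [x [x01 xc hx]] := node_level_other c01.
      by exists (SigSub (in01 _ x01)); split => /=; [rewrite fh|apply: far; rewrite ?fh].
    * have -> : C = f @^-1` [set h c] `&`
          [set u | (M n)%:R^-1 <= `|set_val u - c|] by [].
      apply: closedI; first exact: closed_level.
      apply: (@closed_comp _ _ (fun u : unit_interval R => `|set_val u - c|)
        [set x | (M n)%:R^-1 <= x]).
        by move=> u _; exact: dist_continuous.
      exact: closed_ge.
    * by move=> u [].
    * move=> u m i Cu; apply/eqP => uE; have /eqP := Cc u Cu; apply.
      rewrite uE; apply: inj => //; last by rewrite -uE -fh; case: Cu.
      have hu : h (set_val u) = h c by rewrite -fh; case: Cu.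
      have /andP[h0 h1] := interior _ c01; rewrite -uE !lt_neqAle.
      have /andP[-> ->] := ends u; rewrite !andbT; apply/andP; split; apply/eqP => xE.
        by move: h0; rewrite -hu -xE ltxx.
      by move: h1; rewrite -hu xE ltxx.
    * move=> u [fu uc]; exists (M n)%:R^-1 => // v fv uv; split => //.
      by apply: far => //; apply: contraTneq uv => ->; rewrite -leNgt.
  + split; first by rewrite inE /= fh.
    exists [set u | `|set_val u - c| < (M n)%:R^-1].
      apply: open_nbhs_nbhs; split; last by rewrite /= subrr normr0.
      apply: (@open_comp _ _ (fun u : unit_interval R => `|set_val u - c|)
        [set x | x < (M n)%:R^-1]).
        by move=> u _; exact: dist_continuous.
      exact: open_lt.
    apply/seteqP; split => [u [/= uc fu]|_ -> /=].
      apply: val_inj => /=; apply/eqP; apply: contraTT uc => uc.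
      by rewrite -leNgt; exact: far.
    by rewrite subrr normr0 fh.
  + apply/seteqP; split => [u /= fu|u [[]//|-> /=]]; last by rewrite fh.
    have [uc|uc] := eqVneq (set_val u) c; first by right; apply: val_inj.
    by left; split => //; exact: far.
Qed.

End levels.

(** * Translates of positive measure *)

Section borel.
Context {R : realType} {V : normedModType R}.
Local Notation BV := (borel_type V).

Lemma closed_borel (F : set V) : closed F -> measurable (F : set BV).
Proof.
move=> cF; rewrite -[F]setCK; apply: measurableC.
by apply: sub_sigma_algebra; exact: closed_openC.
Qed.

Lemma continuous_borel_fun (X : V -> R) : continuous X ->
  measurable_fun [set: BV] (X : BV -> R).
Proof.
move=> /continuousP cX; apply: (measurability _ (RGenOpens.measurableE R)).
move=> _ [_ [a [b ->]] <-]; rewrite setTI; apply: sub_sigma_algebra.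
by apply: cX; exact: interval_open.
Qed.

Lemma translate_borel (B : set V) (f : V) : measurable (B : set BV) ->
  measurable ([set g + f | g in B] : set BV).
Proof.
move=> mB; pose t : BV -> BV := fun g : V => g - f.
have -> : [set g + f | g in B] = t @^-1` B.
  apply/seteqP; split => [_ [g Bg <-]|g Bg] /=; first by rewrite /t addrK.
  by exists (g - f) => //; rewrite subrK.
rewrite -[_ @^-1` _]setTI.
suff mt : measurable_fun [set: BV] t by exact: mt.
apply: (@measurability _ _ BV BV setT t (@open V)) => // _ [U oU <-].
rewrite setTI; apply: sub_sigma_algebra; apply: open_comp oU => g _.
by apply: (@cvgB R V _ (nbhs g)); [exact: cvg_id|exact: cvg_cst].
Qed.

(** If all translates of a Borel set B containing S were null, the translate
    of B by - f would be a null set containing the non-null set K. *)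
Lemma not_shy (S : set V) :
  (forall mu : probability BV R, exists (K : set V) (f : V),
     [/\ measurable (K : set BV), mu K != 0%E & forall g, K g -> S (g + f)]) ->
  ~ shy S.
Proof.
move=> catch [B [mu [mB SB null]]].
have [K [f [mK muK KS]]] := catch mu.
have : (mu K <= mu [set (g + (- f))%R | g in B])%E.
  apply: le_measure; rewrite ?inE//; first exact: translate_borel.
  by move=> g Kg; exists (g + f); [exact/SB/KS|rewrite addrK].
by rewrite null measure_le0 (negbTE muK).
Qed.

End borel.

Section exhaustion.
Local Open Scope ereal_scope.
Context d (T : measurableType d) (R : realType) (mu : probability T R).

(** At step n choose k n so that at most the measure 1 / 2^(n + 2) is lost;
    then at most one half is lost altogether.  For classes of functions this
    is the content of the tightness of mu. *)
Lemma exhaustions_common_positive (F : nat -> nat -> set T) :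
  (forall n k, measurable (F n k)) ->
  (forall n, nondecreasing_seq (F n)) ->
  (forall n, \bigcup_k F n k = setT) ->
  exists k : nat -> nat, mu (\bigcap_n F n (k n)) != 0.
Proof.
move=> mF ndF UF.
have small n : exists k, mu (~` F n k) <= ((2^-1 / (2 ^ n.+1)%:R)%R)%:E.
  have : (mu \o F n) x @[x --> \oo] --> mu (\bigcup_k F n k).
    apply: nondecreasing_cvg_mu => //; rewrite UF; exact: measurableT.
  rewrite UF probability_setT => /fine_cvgP[_ /cvgrPdist_le].
  have e0 : (0 < 2^-1 / (2 ^ n.+1)%:R :> R)%R.
    by rewrite divr_gt0// ltr0n expn_gt0.
  move=> /(_ _ e0)[k _ /(_ k (leqnn k))] /=; exists k.
  rewrite probability_setC// -[mu _]fineK ?fin_num_measure//.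
  by rewrite -EFinB lee_fin (le_trans (ler_norm _)).
have [k kP] := choice small; exists k.
have mC : measurable (\bigcup_n ~` F n (k n)).
  by apply: bigcupT_measurable => n; exact: measurableC.
have le2 : mu (\bigcup_n ~` F n (k n)) <= (2^-1%R)%:E.
  apply: le_trans (generalized_Boole_inequality mu _ mC) _.
    by move=> n; exact: measurableC.
  apply: le_trans (epsilon_trick0 xpredT (_ : (0 <= 2^-1 :> R)%R)); last by rewrite invr_ge0.
  by apply: lee_nneseries => // n _; exact: kP.
apply/eqP => null.
have := probability_setC mu mC; rewrite setC_bigcup.
under eq_bigcapr do rewrite setCK.
rewrite null => /esym/eqP.
move: le2; rewrite -[mu _]fineK ?fin_num_measure//.
by rewrite -EFinB lee_fin eqe; lra.
Qed.

End exhaustion.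

(** * Classes of functions with a common modulus of continuity *)

Section oscillation.
Context {R : realType}.
Implicit Types (g : C01 R) (u v : unit_interval R).

Definition osc_le (d e : R) : set (C01 R) :=
  [set g | forall u v, `|set_val u - set_val v| <= d -> `|g u - g v| <= e].

Lemma unit_dist_le1 u v : `|set_val u - set_val v| <= 1.
Proof.
by have := unit_bounds u; have := unit_bounds v; rewrite ler_norml; lra.
Qed.

Lemma eval_continuous u : continuous (fun g : C01 R => g u).
Proof.
move=> g; apply: (@cvgrPdist_lt R R _ (nbhs g) (nbhs_filter g) _ _).2 => e e0.
apply: (@filterS _ (nbhs g) (nbhs_filter g)) (nbhsx_ballx g e e0) => f.
rewrite C01_ballE; apply: le_lt_trans; exact: (sup_norm_ge (g - f) u).
Qed.

Lemma eval_diff_continuous u v : continuous (fun g : C01 R => g u - g v).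
Proof.
by move=> g; apply: (@cvgB R R _ (nbhs g)); exact: eval_continuous.
Qed.

Lemma closed_osc_le d e : closed (osc_le d e).
Proof.
have -> : osc_le d e =
    \bigcap_(p in [set p : unit_interval R * unit_interval R |
                   `|set_val p.1 - set_val p.2| <= d])
      [set g : C01 R | `|g p.1 - g p.2| <= e].
  apply/seteqP; split => [g og [u v] /= uv|g og u v uv]; first exact: og.
  exact: (og (u, v)).
apply: closed_bigI => -[u v] _ /=.
apply: (@closed_comp _ _ (fun g : C01 R => `|g u - g v|) [set x | x <= e]);
  last exact: closed_le.
by move=> g _; apply: (@cvg_norm R R _ (nbhs g)); exact: eval_diff_continuous.
Qed.

Lemma osc_le_mono d d' e e' : d' <= d -> e <= e' -> osc_le d e `<=` osc_le d' e'.
Proof.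
move=> dd ee g og u v uv; apply: le_trans ee; apply: og; exact: le_trans dd.
Qed.

Lemma osc_le_bounded g : exists n, osc_le 1 n.+1%:R g.
Proof.
exists (Num.truncn (`|g| + `|g|)) => u v _.
apply: ltW; apply: le_lt_trans (real_truncnS_gt (num_real _)).
by rewrite (le_trans (ler_normB _ _))// lerD// sup_norm_ge.
Qed.

Lemma osc_le_uniform g (e : R) : 0 < e -> exists n, osc_le n.+1%:R^-1 e g.
Proof.
move=> e0.
pose P (n : nat) u := forall v, `|set_val u - set_val v| <= n.+1%:R^-1 -> `|g u - g v| <= e.
suff : \forall n \near \oo, [set: unit_interval R] `<=` P n.
  by move=> [n _ /(_ n (leqnn n)) Pn]; exists n => u v; exact: Pn.
have /compact_near_coveringP := @unit_interval_compact R; apply => p _.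
have e2 : 0 < e / 2 by lra.
have /cvgrPdist_lt /(_ _ e2) := @C01_continuous R g p.
move=> [_ [[W oW <-] Wp WU]].
have [d d0 dW] : exists2 d : R, 0 < d &
    forall u, `|set_val p - set_val u| < d -> `|g p - g u| < e / 2.
  have /nbhs_ballP[d d0 dW] : nbhs (set_val p) W by exact: open_nbhs_nbhs.
  by exists d => // u pu; apply: WU; exact: dW.
have d2 : 0 < d / 2 by apply: divr_gt0.
have /cvgrPdist_lt /(_ _ d2) [N _ NP] := @cvg_harmonic R.
exists ([set u | `|set_val p - set_val u| < d / 2], [set n | (N <= n)%N]).
  split; last by exists N.
  apply: open_nbhs_nbhs; split; last by rewrite /= subrr normr0.
  apply: (@open_comp _ _ (fun u : unit_interval R => `|set_val p - set_val u|)
    [set x | x < d / 2]);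
    last exact: open_lt.
  move=> u _; apply: (@cvg_norm R R _ (nbhs u)); apply: (@cvgB R R _ (nbhs u)).
    exact: cvg_cst.
  exact: initial_continuous.
move=> [u n] /= [pu Nn] v uv.
have := NP n Nn; rewrite /= sub0r normrN ger0_norm ?invr_ge0// => nd.
have gu : `|g p - g u| < e / 2.
  by apply: dW; apply: lt_trans pu _; lra.
have gv : `|g p - g v| < e / 2.
  apply: dW.
  rewrite (_ : _ - _ = (set_val p - set_val u) + (set_val u - set_val v)); last ring.
  rewrite [d]splitr; apply: le_lt_trans (ler_normD _ _) _.
  by apply: ltrD; [exact: pu|exact: le_lt_trans uv nd].
rewrite (_ : g u - g v = (g p - g v) - (g p - g u)); last ring.
by apply: le_trans (ler_normB _ _) _; lra.
Qed.

(** The bound at index 0 decides the amplitude of the zigzag function, and the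
    radii at the other indices decide its meshes. *)
Definition modulus_class (n k : nat) : set (C01 R) :=
  if n is 0%N then osc_le 1 k.+1%:R else osc_le k.+1%:R^-1 (2^-1 ^+ n).

Definition equicontinuous_class (k : nat -> nat) : set (C01 R) :=
  \bigcap_n modulus_class n (k n).

Lemma borel_modulus_class n k :
  measurable (modulus_class n k : set (borel_type (C01 R))).
Proof. by apply: closed_borel; case: n => [|n]; exact: closed_osc_le. Qed.

Lemma borel_equicontinuous_class k :
  measurable (equicontinuous_class k : set (borel_type (C01 R))).
Proof. by apply: bigcapT_measurable => n; exact: borel_modulus_class. Qed.

Lemma equicontinuous_class_positive (mu : probability (borel_type (C01 R)) R) :
  exists k, mu (equicontinuous_class k) != 0%E.
Proof.
apply: exhaustions_common_positive => [||n].
- exact: borel_modulus_class.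
- move=> n k k' kk'; apply/subsetPset; case: n => [|n]; apply: osc_le_mono => //.
    by rewrite ler_nat.
  by rewrite lef_pV2 ?posrE// ler_nat.
- apply/seteqP; split => // g _; case: n => [|n].
    by have [k gk] := osc_le_bounded g; exists k.
  have e0 : 0 < 2^-1 ^+ n.+1 :> R by rewrite exprn_gt0 ?invr_gt0.
  by have [k gk] := osc_le_uniform g e0; exists k.
Qed.

Lemma equicontinuous_classN k g :
  equicontinuous_class k g -> equicontinuous_class k (- g).
Proof.
move=> gk n _; have := gk n I; case: n => [|n] og u v uv.
all: by rewrite !C01_oppE -opprD normrN; exact: og.
Qed.

End oscillation.

Section shift.
Context {R : realType}.
Variable k : nat -> nat.

(** The factor 64 leaves a bound of 4 L / 2^n in the hypothesis of the perturbation
    lemmas, where L = k 0 + 1: 3 / 2^n for a linear term of slope at most 1, and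
    L / 2^n for a function in the class. *)
Definition class_amplitude : R := 64 * (k 0).+1%:R.
(** With this parameter the mesh n + 1 has at least 3 (k (n + 1) + 1) segments,
    hence 3 of them fit into the radius attached to the oscillation
    1 / 2^(n + 1). *)
Definition class_branching (n : nat) : nat := (3 * k n.+1)%N.

Lemma class_amplitude_gt0 : 0 < class_amplitude.
Proof. by rewrite mulr_gt0. Qed.

(** The map phi is a contraction such as the projection onto the unit interval;
    it extends g to the line, where the zigzag function lives. *)
Lemma class_modulus (g : C01 R) (c : R) (phi : R -> unit_interval R) :
  equicontinuous_class k g -> 0 <= c <= 1 ->
  (forall x y, `|set_val (phi x) - set_val (phi y)| <= `|x - y|) ->
  forall n x y, `|x - y| <= 3 / (mesh class_branching n)%:R ->
    `|(c * set_val (phi x) + g (phi x)) - (c * set_val (phi y) + g (phi y))|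
      <= class_amplitude * 2^-1 ^+ n / 16.
Proof.
move=> gk c01 phi1 n x y xy.
have L1 : 1 <= (k 0).+1%:R :> R by rewrite ler1n.
have p0 : 0 < 2^-1 ^+ n :> R by rewrite exprn_gt0 ?invr_gt0.
have lin : `|set_val (phi x) - set_val (phi y)| <= 3 * 2^-1 ^+ n.
  apply: le_trans (phi1 x y) (le_trans xy _); rewrite ler_pM2l// exprVn.
  rewrite lef_pV2 ?posrE ?exprn_gt0 ?meshR_gt0// -natrX ler_nat.
  by apply: leq_trans (mesh_ge _ _); case: (n) => // m; rewrite leq_exp2r.
have gl : `|g (phi x) - g (phi y)| <= (k 0).+1%:R * 2^-1 ^+ n.
  have := gk n I; case: n xy p0 lin => [|n] xy p0 lin og.
    by rewrite expr0 mulr1; apply: og; exact: unit_dist_le1.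
  apply: le_trans (_ : 2^-1 ^+ n.+1 <= _); last by rewrite ler_peMl// ltW.
  apply: og; apply: le_trans (phi1 x y) (le_trans xy _).
  rewrite ler_pdivrMr ?meshR_gt0// ler_pdivlMl ?ltr0n// -natrM ler_nat /=.
  rewrite /branching /class_branching.
  by apply: leq_trans (leq_pmull _ (mesh_gt0 _ _)); lia.
have -> : (c * set_val (phi x) + g (phi x)) - (c * set_val (phi y) + g (phi y)) =
  c * (set_val (phi x) - set_val (phi y)) + (g (phi x) - g (phi y)) by ring.
apply: le_trans (ler_normD _ _) _; rewrite normrM (ger0_norm (_ : 0 <= c)); last lra.
move: p0 lin gl L1; rewrite /class_amplitude.
set p := 2^-1 ^+ n; set L := (k 0).+1%:R; set a := `|set_val _ - _|; set b := `|_ - _|.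
move=> p0 lin gl L1; have ca : c * a <= a by rewrite ler_piMl//; [exact: normr_ge0|lra].
have Lp : p <= L * p by rewrite ler_peMl// ltW.
lra.
Qed.

End shift.

(** * Both halves of the ambivalence *)

Section atoms.
Context d (T : measurableType d) (R : realType) (mu : probability T R).

(** The real distribution of X has countably many atoms. *)
Lemma countable_affine_atoms (X : T -> R) (a b : R) :
  measurable_fun setT X -> b != 0 ->
  countable [set c | mu (X @^-1` [set a + c * b]) != 0%E].
Proof.
move=> mX b0; pose Y : {RV mu >-> R} := HB.pack X (isMeasurableFun.Build _ _ T R X mX).
apply: (@sub_countable _ _ _ ((fun r => (r - a) / b) @` [set r | 0 < pmf Y r])).
  apply: subset_card_le => c /= muc; exists (a + c * b); last by rewrite addrC addKr mulfK.
  rewrite /pmf fine_gt0// lt_neqAle eq_sym muc measure_ge0/=.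
  rewrite ltey_eq fin_num_measure// -[_ @^-1` _]setTI.
  exact (mX measurableT _ (measurable_set1 _)).
exact: sub_countable (card_image_le _ _) (pmf_gt0_countable Y).
Qed.

Lemma measure_setD_null (K : set T) (I : countType) (Z : I -> set T) :
  measurable K -> (forall i, measurable (Z i)) -> (forall i, mu (Z i) = 0%E) ->
  mu K != 0%E ->
  measurable (K `\` \bigcup_i Z i) /\ mu (K `\` \bigcup_i Z i) != 0%E.
Proof.
move=> mK mZ Z0 muK.
have mU : measurable (\bigcup_i Z i).
  by apply: countable_bigcupT_measurable; [exact: countableP|].
have mD : measurable (K `\` \bigcup_i Z i) by exact: measurableD.
split => //; apply: contra_neq muK => D0.
pose W n := if unpickle n is Some i then Z i else set0.
apply/(negligibleP _ mK).
apply: (@negligibleS _ _ _ _ ((K `\` \bigcup_i Z i) `|` \bigcup_n W n)).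
  move=> x Kx; have [[i _ Zi]|nx] := pselect ((\bigcup_i Z i) x); last by left.
  by right; exists (pickle i) => //; rewrite /W pickleK.
apply: negligibleU; first exact/negligibleP.
apply: negligible_bigcup => n; rewrite /W; case: unpickle => [i|]; last exact: negligible_set0.
by apply/negligibleP => //; exact: Z0.
Qed.

End atoms.

Section ambivalence.
Context {R : realType}.
Local Notation V := (C01 R).

Lemma clamp_subproof (x : R) : Num.max 0 (Num.min x 1) \in `[0 : R, 1]%classic.
Proof.
by rewrite inE /= in_itv /= le_max lexx ge_max ge_min lexx orbT ler01.
Qed.

Definition clamp (x : R) : unit_interval R := SigSub (clamp_subproof x).

Lemma clampE x : 0 <= x <= 1 -> set_val (clamp x) = x.
Proof.
move=> /andP[x0 x1].
by rewrite -[LHS]/(Num.max 0 (Num.min x 1)) (min_idPl x1) (max_idPr x0).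
Qed.

Lemma clamp_val (u : unit_interval R) : clamp (set_val u) = u.
Proof.
apply: val_inj; rewrite [LHS]clampE//; exact: unit_bounds.
Qed.

Lemma clamp_contract x y : `|set_val (clamp x) - set_val (clamp y)| <= `|x - y|.
Proof.
wlog xy : x y / x <= y => [wl|].
  have [|/ltW] := leP x y => /wl//.
  by rewrite distrC [leRHS]distrC.
rewrite [leRHS]distrC (ger0_norm (_ : 0 <= y - x)) ?subr_ge0//.
rewrite -[set_val (clamp x)]/(Num.max 0 (Num.min x 1)).
rewrite -[set_val (clamp y)]/(Num.max 0 (Num.min y 1)).
rewrite ler_norml !maxEle !minEle.
by case: (leP x 1) => ?; case: (leP y 1) => ?; rewrite ?ler01;
  case: (leP 0 x) => ?; case: (leP 0 y) => ?; lra.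
Qed.

Lemma cantor_set_two_points (A : set (unit_interval R)) :
  is_cantor_set A -> exists u v, [/\ A u, A v & u != v].
Proof.
move=> [f [g [_ _ _ gK]]].
pose z : (@middle_third_cantor R : Type) := SigSub (mem_set middle_third_0).
pose o : (@middle_third_cantor R : Type) := SigSub (mem_set middle_third_1).
exists (set_val (g z)), (set_val (g o)); split; try exact: set_valP.
apply/eqP => /val_inj /(can_inj gK) /(congr1 set_val) /= /eqP.
by rewrite eq_sym oner_eq0.
Qed.

Lemma bruckner_garg_no_singleton (f : V) y u :
  bruckner_garg f -> min_value f < y < max_value f -> f @^-1` [set y] <> [set u].
Proof.
move=> [D [_ DmM _ [_ cantor_levels isolated_levels]]] ymM fu.
have [Dy|nDy] := pselect (D y).
  have [C [x [/cantor_set_two_points[v [w [Cv Cw vw]]] _]]] := isolated_levels y Dy.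
  rewrite fu => uE; case/eqP: vw.
  have eq_u z : C z -> z = u by move=> Cz; have : [set u] z by rewrite uE; left.
  by rewrite (eq_u v)// (eq_u w).
have [] := cantor_set_two_points (cantor_levels y _); first by split => //=; rewrite in_itv.
by rewrite fu => v [w [-> ->]]; rewrite eqxx.
Qed.

Lemma restriction_continuous (f : R -> R) : continuous f ->
  continuous (fun u : unit_interval R => f (set_val u)).
Proof.
move=> cf u; apply: (@continuous_comp _ _ _ set_val f); last exact: cf.
exact: initial_continuous.
Qed.

Definition restriction (f : R -> R) (cf : continuous f) : V :=
  mkcts (restriction_continuous cf).

Lemma restrictionE (f : R -> R) (cf : continuous f) u : restriction cf u = f (set_val u).
Proof. by []. Qed.

(** Adding c id, with c outside a countable set, separates the values at all
    pairs of nodes for almost every g of the class. *)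
Lemma bruckner_garg_not_shy : ~ shy [set f : V | bruckner_garg f].
Proof.
apply: not_shy => mu.
have [k muK] := equicontinuous_class_positive mu.
set K := equicontinuous_class k in muK.
pose A : R := class_amplitude k; pose b := class_branching k.
have A0 : 0 < A := class_amplitude_gt0 k.
pose d1 (p : (nat * nat) * (nat * nat)) : R := node b p.1.1 p.1.2.
pose d2 (p : (nat * nat) * (nat * nat)) : R := node b p.2.1 p.2.2.
pose inner p := [/\ 0 < d1 p < 1, 0 < d2 p < 1 & d1 p != d2 p].
pose X p (g : borel_type V) : R := (g : V) (clamp (d1 p)) - (g : V) (clamp (d2 p)).
have mX p : measurable_fun setT (X p).
  by apply: continuous_borel_fun; exact: eval_diff_continuous.
(* f d1 + c d1 + g d1 = f d2 + c d2 + g d2 prescribes the value of X p at g. *)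
pose bad p := [set c | inner p /\
  mu (X p @^-1` [set (zigzag A b (d2 p) - zigzag A b (d1 p)) + c * (d2 p - d1 p)]) != 0%E].
have [c [c01 cgood]] : exists c, 0 <= c <= 1 /\ forall p, ~ bad p c.
  have cb : countable (\bigcup_p bad p).
    apply: bigcup_countable => // p _.
    have [ip|nip] := pselect (inner p); last first.
      by rewrite (_ : bad p = set0)//; apply/seteqP; split => // c [].
    apply: sub_countable (countable_affine_atoms mu
      (zigzag A b (d2 p) - zigzag A b (d1 p)) (mX p) (_ : d2 p - d1 p != 0)).
      by apply: subset_card_le => c [].
    by rewrite subr_eq0 eq_sym; case: ip.
  (* A countable set is Lebesgue null, so it does not cover [0, 1]. *)
  apply: contrapT => none.
  have sub : `[0 : R, 1]%classic `<=` \bigcup_p bad p.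
    move=> c; rewrite /= in_itv /= => c01; apply: contrapT => nc.
    by apply: none; exists c; split => // p bp; apply: nc; exists p.
  have := countable_lebesgue_measure0 (sub_countable (subset_card_le sub) cb).
  by rewrite lebesgue_measure_itv /= lte_fin ltr01 oppr0 adde0 => /eqP; rewrite eqe oner_eq0.
have cf : continuous (fun x => zigzag A b x + c * x).
  move=> x; apply: cvgD; first exact: zigzag_continuous.
  by apply: cvgM; [exact: cvg_cst|exact: cvg_id].
pose Z p : set (borel_type V) := if pselect (inner p) then
  X p @^-1` [set (zigzag A b (d2 p) - zigzag A b (d1 p)) + c * (d2 p - d1 p)] else set0.
have mZ p : measurable (Z p).
  rewrite /Z; case: pselect => //= ip.
  by rewrite -[_ @^-1` _]setTI; exact (mX p measurableT _ (measurable_set1 _)).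
have Z0 p : mu (Z p) = 0%E.
  rewrite /Z; case: pselect => /= [ip|nip]; last exact: measure0.
  by apply/eqP; apply: contrapT => /negP ne; apply: (cgood p); split.
have [mK' muK'] := measure_setD_null (borel_equicontinuous_class k) mZ Z0 muK.
exists (K `\` \bigcup_p Z p), (restriction cf); split => // g [Kg nZ].
pose G x := c * set_val (clamp x) + g (clamp x).
have Gmod := class_modulus Kg c01 clamp_contract.
apply: (@bruckner_garg_perturbed R A b G A0 Gmod).
  move=> u; rewrite C01_addE /perturbed /G clamp_val.
  by rewrite restrictionE; ring.
move=> n i m j ni mj; rewrite /perturbed /G => eqv; apply/eqP; apply: contraT => ne.
pose p := ((n, i), (m, j)).
case: nZ; exists p => //; rewrite /Z; case: pselect => /= [ip|[]]; last by split.
rewrite /X /= /d1 /d2 /=.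
have ci : set_val (clamp (node b n i)) = node b n i by apply: clampE; lra.
have cj : set_val (clamp (node b m j)) = node b m j by apply: clampE; lra.
by move: eqv; rewrite ci cj; lra.
Qed.

(** On each half of the interval f is a zigzag function that starts at 1/2, so
    the minimum at 0 of the perturbed zigzag function shows that f + g crosses
    its level at 1/2 only there. *)
Lemma bruckner_garg_not_prevalent : ~ prevalent [set f : V | bruckner_garg f].
Proof.
apply: not_shy => mu.
have [k muK] := equicontinuous_class_positive mu.
set K := equicontinuous_class k in muK.
pose A : R := class_amplitude k; pose b := class_branching k.
have A0 : 0 < A := class_amplitude_gt0 k.
(* One of the two terms vanishes, since zigzag is 0 on the negative half-line. *)
pose F x := zigzag A b (2 * x - 1) - zigzag A b (1 - 2 * x).
have cF : continuous F.
  move=> x; have zc := @zigzag_continuous R A b A0.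
  apply: cvgB; apply: continuous_comp; try exact: zc.
    apply: cvgB; last exact: cvg_cst.
    by apply: cvgM; [exact: cvg_cst|exact: cvg_id].
  apply: cvgB; first exact: cvg_cst.
  by apply: cvgM; [exact: cvg_cst|exact: cvg_id].
exists K, (restriction cF); split => //; first exact: borel_equicontinuous_class.
move=> g Kg; set f := g + restriction cF; pose m := clamp (2^-1).
have mE : set_val m = 2^-1 by apply: clampE; lra.
have zero : zigzag A b 0 = 0 by exact: zigzag_neg.
have ends := @unit_bounds R.
have fm : f m = g m.
  rewrite C01_addE restrictionE /F mE.
  rewrite (_ : 2 * 2^-1 - 1 = 0 :> R); last by field.
  by rewrite (_ : 1 - 2 * 2^-1 = 0 :> R) ?subrr ?addr0//; field.
have zero01 : 0 <= (0 : R) <= 1 by lra.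
have right u : 2^-1 < set_val u -> f m < f u.
  move=> mu'; pose phi t := clamp (2^-1 * t + 2^-1).
  have phi1 s t : `|set_val (phi s) - set_val (phi t)| <= `|s - t|.
    apply: le_trans (clamp_contract _ _) _.
    rewrite (_ : _ - _ = 2^-1 * (s - t)); last ring.
    by rewrite normrM (ger0_norm (_ : 0 <= 2^-1)) ?invr_ge0// ler_piMl//; lra.
  have Gmod := class_modulus Kg zero01 phi1.
  have u01 := ends u.
  have := perturbed_min A0 Gmod (x := 2 * set_val u - 1).
  rewrite /perturbed zero !mul0r !add0r fm C01_addE.
  rewrite restrictionE /F (@zigzag_neg R A b A0 (1 - 2 * set_val u)); last lra.
  rewrite /phi mulr0 add0r -/m (_ : 2^-1 * _ + _ = set_val u); last by field.
  by rewrite clamp_val; lra.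
have left u : set_val u < 2^-1 -> f u < f m.
  move=> um; pose phi t := clamp (2^-1 - 2^-1 * t).
  have phi1 s t : `|set_val (phi s) - set_val (phi t)| <= `|s - t|.
    apply: le_trans (clamp_contract _ _) _.
    rewrite (_ : _ - _ = - (2^-1 * (s - t))); last ring.
    by rewrite normrN normrM (ger0_norm (_ : 0 <= 2^-1)) ?invr_ge0// ler_piMl//; lra.
  (* Reflected in the point 1/2, the left half becomes a perturbation by - g. *)
  have Gmod := class_modulus (equicontinuous_classN Kg) zero01 phi1.
  have u01 := ends u.
  have := perturbed_min A0 Gmod (x := 1 - 2 * set_val u).
  rewrite /perturbed zero !mul0r !add0r fm C01_addE.
  rewrite restrictionE /F (@zigzag_neg R A b A0 (2 * set_val u - 1)); last lra.
  rewrite /phi mulr0 subr0 -/m (_ : 2^-1 - _ = set_val u); last by field.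
  by rewrite clamp_val !C01_oppE; lra.
move=> /(@bruckner_garg_no_singleton f (f m) m); apply.
  have [? _ /(_ (clamp 0)) mn] := min_valueP f.
  have [? _ /(_ (clamp 1)) mx] := max_valueP f.
  apply/andP; split.
    by apply: le_lt_trans mn _; apply: left; rewrite clampE//; lra.
  by apply: lt_le_trans mx; apply: right; rewrite clampE//; lra.
apply/seteqP; split => [u fu|_ -> //].
have {}fu : f u = f m by [].
have [/left|/right|um] := ltrgtP (set_val u) 2^-1.
- by rewrite fu ltxx.
- by rewrite fu ltxx.
- by apply: val_inj; exact: etrans um (esym mE).
Qed.

End ambivalence.

Theorem theorem3p3 (R : realType) :
  haar_ambivalent [set f : C01 R | bruckner_garg f].
Proof. split; [exact: bruckner_garg_not_shy|exact: bruckner_garg_not_prevalent]. Qed.
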